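(* Let $(G,\Omega)$ be a flat symplectic Lie group. Then the left-invariant symplectic connection $\nabla$ of $(G,\Omega)$ is geodesically complete.
   Context: A symplectic Lie group $(G,\Omega)$ is a (real, finite-dimensional) Lie group $G$ with a left-invariant symplectic form $\Omega$. Let $\mathfrak{g}$ be its Lie algebra, $\omega=\Omega(e)$, and for $u\in\mathfrak{g}$ let $u^+$ be the associated left-invariant vector field. Define the product $\bullet$ on $\mathfrak{g}$ by $\omega(u\bullet v,w)=\frac13\big(\omega([u,v],w)+\omega([u,w],v)\big)$ for all $u,v,w\in\mathfrak{g}$. The connection $\nabla$ of $(G,\Omega)$ is the left-invariant connection determined by $\nabla_{u^+}v^+=(u\bullet v)^+$; it is torsion free and satisfies $\nabla\Omega=0$. $(G,\Omega)$ is called flat if the curvature of $\nabla$ vanishes identically. *)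

(* Defs.v *)
From HB Require Import structures.
From mathcomp Require Import all_boot all_order all_algebra.
From mathcomp Require Import all_classical all_reals all_analysis.

Set Implicit Arguments.
Unset Strict Implicit.
Unset Printing Implicit Defensive.

Import Order.TTheory GRing.Theory Num.Theory.
Import numFieldNormedType.Exports.

Local Open Scope classical_set_scope.
Local Open Scope ring_scope.

(* [Ck k U f]: between finite-dimensional spaces, f is of class C^k on the open
   set U, i.e. its directional derivatives up to order k exist on U, those of
   order < k are Fréchet differentiable on U, and those of order k are
   continuous on U. *)
Fixpoint Ck (R : realType) (V W : normedModType R) (k : nat)
    (U : set V) (f : V -> W) : Prop :=
  match k with
  | 0%N => forall x, U x -> {for x, continuous f}
  | k'.+1 => (forall x, U x -> differentiable f x) /\
             (forall v, Ck k' U (fun x => 'D_v f x))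
  end.

Definition smooth_on (R : realType) (V W : normedModType R)
    (U : set V) (f : V -> W) : Prop := forall k, Ck k U f.

(* A chart is a homeomorphism [cphi] from the open set [cdom] of M onto the open
   set [ccod] of R^n, with inverse [cpsi]; both maps are totalized by arbitrary
   values outside of these sets. *)
Record chart (R : realType) (n : nat) (M : topologicalType) := Chart {
  cdom : set M;
  ccod : set 'rV[R]_n;
  cphi : M -> 'rV[R]_n;
  cpsi : 'rV[R]_n -> M;
  cdom_open : open cdom;
  ccod_open : open ccod;
  cphi_cod : forall p, cdom p -> ccod (cphi p);
  cpsi_dom : forall x, ccod x -> cdom (cpsi x);
  cphiK : forall p, cdom p -> cpsi (cphi p) = p;
  cpsiK : forall x, ccod x -> cphi (cpsi x) = x;
  cphi_continuous : forall p, cdom p -> {for p, continuous cphi};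
  cpsi_continuous : forall x, ccod x -> {for x, continuous cpsi} }.

(* Smooth manifolds without boundary of pure dimension n. The atlas is not
   assumed to be maximal. Each point p has a preferred chart [chart_at p]. *)
HB.mixin Record isSmoothManifold (R : realType) (n : nat) M
    of Topological M := {
  chart_idx : Type;
  atlas : chart_idx -> chart R n M;
  chart_at : M -> chart_idx;
  chart_at_dom : forall p, cdom (atlas (chart_at p)) p;
  atlas_compat : forall i j,
    smooth_on [set x | ccod (atlas i) x /\ cdom (atlas j) (cpsi (atlas i) x)]
      (fun x => cphi (atlas j) (cpsi (atlas i) x));
  manifold_hausdorff : hausdorff_space M;
  manifold_second_countable : @second_countable M }.

#[short(type="smoothManifoldType")]
HB.structure Definition SmoothManifold (R : realType) (n : nat) :=
  { M of isSmoothManifold R n M & Topological M }.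

Section manifold.
Context {R : realType} {n : nat} {M : smoothManifoldType R n}.
Local Notation E := 'rV[R]_n.
Implicit Types (p : M) (i j : @chart_idx R n M).

Definition phi_at p : M -> E := cphi (@atlas R n M (chart_at p)).
Definition psi_at p : E -> M := cpsi (@atlas R n M (chart_at p)).

(* The tangent space T_pM is E, a tangent vector at p being given by its
   components in the chart [chart_at p]. A vector field is thus a function
   X : M -> E where X p is read in T_pM.
   [tcoord p i v]: components in the chart i of the tangent vector v at p. *)
Definition tcoord p i (v : E) : E :=
  'd (fun x => cphi (atlas i) (psi_at p x)) (phi_at p p) v.

(* [tvect i x w]: tangent vector at the point of coordinates x in the chart i
   whose components in this chart are w. *)
Definition tvect i (x w : E) : E :=
  'd (fun y => phi_at (cpsi (atlas i) x) (cpsi (atlas i) y)) x w.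

Definition vf_coord (X : M -> E) i (x : E) : E :=
  tcoord (cpsi (atlas i) x) i (X (cpsi (atlas i) x)).

Definition smooth_vf (X : M -> E) : Prop :=
  forall i, smooth_on (ccod (@atlas R n M i)) (vf_coord X i).

(* [X, Y]^k = X^l d_l Y^k - Y^l d_l X^k, computed at p in [chart_at p]. *)
Definition lie_bracket (X Y : M -> E) (p : M) : E :=
  'D_(X p) (vf_coord Y (chart_at p)) (phi_at p p)
  - 'D_(Y p) (vf_coord X (chart_at p)) (phi_at p p).

Definition form_coord (Omega : M -> E -> E -> R) i (x u v : E) : R :=
  Omega (cpsi (atlas i) x) (tvect i x u) (tvect i x v).

Definition smooth_form (Omega : M -> E -> E -> R) : Prop :=
  forall i (u v : E),
    smooth_on (ccod (@atlas R n M i))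
      (fun x => form_coord Omega i x u v : R^o).

Definition closed_form (Omega : M -> E -> E -> R) : Prop :=
  forall i (x u v w : E), ccod (@atlas R n M i) x ->
    'D_u (fun y => form_coord Omega i y v w : R^o) x
    + 'D_v (fun y => form_coord Omega i y w u : R^o) x
    + 'D_w (fun y => form_coord Omega i y u v : R^o) x = 0.

Definition symplectic_form (Omega : M -> E -> E -> R) : Prop :=
  [/\ (forall p u, scalar (Omega p u)) /\
        (forall p v, scalar (fun u => Omega p u v)),
      forall p u, Omega p u u = 0,
      forall p u, (forall v, Omega p u v = 0) -> u = 0,
      smooth_form Omega
    & closed_form Omega].

(* An affine connection, given by its Christoffel symbols in each chart:
   [Gamma i x u v] = Gamma^k_{lm}(x) u^l v^m, subject to the change of
   coordinates law, where u is the direction of differentiation. *)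
Record connection := Connection {
  christoffel : @chart_idx R n M -> E -> E -> E -> E;
  christoffel_linearl : forall i x v, linear (fun u => christoffel i x u v);
  christoffel_linearr : forall i x u, linear (christoffel i x u);
  christoffel_smooth : forall i u v,
    smooth_on (ccod (@atlas R n M i)) (fun x => christoffel i x u v);
  christoffel_compat : forall i j x u v,
    ccod (@atlas R n M i) x -> cdom (@atlas R n M j) (cpsi (atlas i) x) ->
    let tau y := cphi (@atlas R n M j) (cpsi (atlas i) y) in
    'd tau x (christoffel i x u v) =
    'D_u (fun y => 'D_v tau y) x
    + christoffel j (tau x) ('d tau x u) ('d tau x v) }.

Definition covariant (nabla : connection) (X Y : M -> E) (p : M) : E :=
  'D_(X p) (vf_coord Y (chart_at p)) (phi_at p p)
  + christoffel nabla (chart_at p) (phi_at p p) (X p) (Y p).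

Definition curvature (nabla : connection) (X Y Z : M -> E) (p : M) : E :=
  covariant nabla X (covariant nabla Y Z) p
  - covariant nabla Y (covariant nabla X Z) p
  - covariant nabla (lie_bracket X Y) Z p.

Definition flat (nabla : connection) : Prop :=
  forall X Y Z, smooth_vf X -> smooth_vf Y -> smooth_vf Z ->
    forall p, curvature nabla X Y Z p = 0.

(* Geodesics on a set I of times, meant to be open: in every chart,
   c'' + Gamma(c)(c', c') = 0. The equation forces them to be smooth. *)
Definition is_geodesic (nabla : connection) (I : set R) (gamma : R -> M) :
    Prop :=
  forall t, I t ->
    {for t, continuous gamma} /\
    forall i, cdom (@atlas R n M i) (gamma t) ->
      let c s : E := cphi (@atlas R n M i) (gamma s) in
      [/\ derivable c t 1, derivable (derive1 c) t 1
        & derive1 (derive1 c) t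
          + christoffel nabla i (c t) (derive1 c t) (derive1 c t) = 0].

(* Every geodesic extends to a geodesic defined on the whole real line. *)
Definition geodesically_complete (nabla : connection) : Prop :=
  forall (I : set R) (gamma : R -> M),
    I !=set0 -> open I -> is_interval I -> is_geodesic nabla I gamma ->
    exists sigma : R -> M,
      is_geodesic nabla setT sigma /\ forall t, I t -> sigma t = gamma t.

End manifold.

Arguments connection {R n} M.

Definition smooth_map (R : realType) (m n : nat) (M : smoothManifoldType R m)
    (N : smoothManifoldType R n) (f : M -> N) : Prop :=
  continuous f /\
  forall (i : @chart_idx R m M) (j : @chart_idx R n N),
    smooth_on
      [set x | ccod (atlas i) x /\ cdom (atlas j) (f (cpsi (atlas i) x))]
      (fun x => cphi (atlas j) (f (cpsi (atlas i) x))).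

(* Smoothness of a map defined on the product manifold M * M. *)
Definition smooth_map2 (R : realType) (m n : nat) (M : smoothManifoldType R m)
    (N : smoothManifoldType R n) (f : M -> M -> N) : Prop :=
  continuous (fun pq : M * M => f pq.1 pq.2) /\
  forall (i j : @chart_idx R m M) (k : @chart_idx R n N),
    smooth_on
      [set x : 'rV[R]_m * 'rV[R]_m |
        [/\ ccod (atlas i) x.1, ccod (atlas j) x.2
          & cdom (atlas k) (f (cpsi (atlas i) x.1) (cpsi (atlas j) x.2))]]
      (fun x => cphi (atlas k) (f (cpsi (atlas i) x.1) (cpsi (atlas j) x.2))).

(* The differential T_pM -> T_{f p}N. *)
Definition tangent_map (R : realType) (m n : nat) (M : smoothManifoldType R m)
    (N : smoothManifoldType R n) (f : M -> N) (p : M) (u : 'rV[R]_m) :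
    'rV[R]_n :=
  'd (fun x => phi_at (f p) (f (psi_at p x))) (phi_at p p) u.

HB.mixin Record SmoothManifold_Group_isLieGroup (R : realType) (n : nat) G
    of SmoothManifold R n G & Group G := {
  smooth_mulg : smooth_map2 (fun g h : G => (g * h)%g);
  smooth_invg : smooth_map (fun g : G => (g^-1)%g) }.

#[short(type="lieGroupType")]
HB.structure Definition LieGroup (R : realType) (n : nat) :=
  { G of SmoothManifold_Group_isLieGroup R n G
       & SmoothManifold R n G & Group G }.

(* The tangent space at the identity. *)
Definition lie_algebra (R : realType) (n : nat) (G : lieGroupType R n) : Type :=
  'rV[R]_n.

Section lie_group.
Context {R : realType} {n : nat} (G : lieGroupType R n).

(* The left-invariant vector field u^+. *)
Definition left_invariant_vf (u : lie_algebra G) (g : G) : 'rV[R]_n :=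
  tangent_map (fun h : G => (g * h)%g) 1%g u.

Definition lie_algebra_bracket (u v : lie_algebra G) : lie_algebra G :=
  lie_bracket (left_invariant_vf u) (left_invariant_vf v) 1%g.

Definition left_invariant_form (Omega : G -> 'rV[R]_n -> 'rV[R]_n -> R) :
    Prop :=
  forall (g p : G) u v,
    Omega (g * p)%g (tangent_map (fun h : G => (g * h)%g) p u)
                    (tangent_map (fun h : G => (g * h)%g) p v)
    = Omega p u v.

(* omega(u . v, w) = 1/3 (omega([u, v], w) + omega([u, w], v)) *)
Definition is_natural_product (omega : lie_algebra G -> lie_algebra G -> R)
    (prod : lie_algebra G -> lie_algebra G -> lie_algebra G) : Prop :=
  forall u v w, omega (prod u v) w =
    3%:R^-1 * (omega (lie_algebra_bracket u v) w
               + omega (lie_algebra_bracket u w) v).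

End lie_group.

(* Main.v *)
Require Import Defs.
From HB Require Import structures.
From mathcomp Require Import all_boot all_order all_algebra.
From mathcomp Require Import all_classical all_reals all_analysis.
From mathcomp Require Import ring lra.
Set Implicit Arguments.
Unset Strict Implicit.
Unset Printing Implicit Defensive.
Import Order.TTheory GRing.Theory Num.Theory.
Import numFieldNormedType.Exports.
Local Open Scope classical_set_scope.
Local Open Scope ring_scope.

(** Left translation to the identity turns geodesics into the flow of
    x' = - x.x on the Lie algebra, where x.y is [bullet x y].  Closedness of Omega
    makes the connection torsion free, so flatness says that the product is left
    symmetric; write L_u v = u.v and R_v u = u.v.  Left symmetry gives
    tr R_v^(k+1) = tr R_(R_v^k v).  Let tr R_u = omega(h, u); then R_h lies in
    sp(omega), L_h = -2 R_h, and flatness forces R_h to commute with every L_a, so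
    that omega(R_h (a.b), c) is skew in b and c.  Hence tr R_v^k = 0 for k >= 3 and
    R_v is nilpotent.  The solution with x(0) = v is then B(t) v, where B solves the
    linear equation B' = - B L_y with y(t) = (1 + t R_v)^-1 v polynomial in t; it is
    defined for all times.  Finally the equation s' = x(t)^+(s) is solved on G with
    a uniform time step by left invariance, and uniqueness of geodesics identifies s
    with the given geodesic. *)

(** * Left symmetric algebras with a symplectic form *)

(** The equation x' = - x.x is quadratic, so its solutions could escape in finite time. Nilpotency
    of the right multiplications forbids this: 1 + t R_v is then invertible for every t, and the
    flow reduces to a linear equation whose coefficients exist on the whole line. The vector h comes
    from nondegeneracy of omega. It is useful because tr R_(u.v) = tr (R_u R_v) is symmetric in u
    and v while every L_u lies in sp(omega); together these force R_h into sp(omega), and the factor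
    1/3 in the product then fixes the multiple of R_h that L_h is. The traces are controlled only
    from the third power on. This suffices because the Fitting projector of R_v is a combination of
    arbitrarily high powers of R_v. On the group only one direction of the correspondence is used: a
    flow line on the Lie algebra yields a geodesic. A given geodesic is never translated to the
    identity over a time interval; only its velocity at one instant is. *)

Lemma mxtrace_idempotent (F : fieldType) n (A : 'M[F]_n) :
  A *m A = A -> \tr A = (\rank A)%:R.
Proof.
(* Full-rank factorization A = L U: cancelling L on the left and U on the right of L U L U = L U
   gives U L = 1, of size the rank. *)
move=> AA; set L := col_base A; set U := row_base A.
have LU : L *m U = A by exact: mulmx_base.
have : L *m (U *m L) *m U = L *m 1%:M *m U.
  by rewrite mulmx1 mulmxA -mulmxA LU.
have fU : row_free U by exact: row_base_free.
have fL : row_full L by exact: col_base_full.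
move=> LUL; have UL := row_full_inj fL (row_free_inj fU LUL).
by rewrite -{1}LU mxtrace_mulC UL mxtrace1.
Qed.

(* Otherwise a power of A times a polynomial in A would be a nonzero idempotent
   (the Fitting projector), whose trace is its rank. *)
Lemma nilpotent_of_mxtrace (F : numFieldType) n (A : 'M[F]_n.+1) (k : nat) :
  (forall j, (k <= j)%N -> \tr (A ^+ j) = 0) -> exists m, A ^+ m = 0.
Proof.
move=> trA.
have [m [q]] := multiplicity_XsubC (char_poly A) 0.
rewrite monic_neq0 ?char_poly_monic //= => q0 charA.
rewrite subr0 in charA.
(* The exponent is m + k and not just m: every monomial of e is then a multiple of some [A ^+ j]
   with j >= k, where the trace is known. *)
have cop : coprimep ('X^(m + k)) q.
  apply: coprimep_expl; rewrite -['X]subr0 -polyC0 coprimep_sym.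
  by rewrite coprimep_XsubC.
have [[u w] /= uw] := Bezout_eq1_coprimepP _ _ cop.
pose e := horner_mx A (u * 'X^(m + k)).
have eE : e = horner_mx A u * A ^+ (m + k).
  by rewrite /e rmorphM rmorphXn /= horner_mx_X.
have wqE : horner_mx A (w * q) = 1 - e.
  by rewrite -(rmorph1 (horner_mx A)) -uw rmorphD /= /e addrAC subrr add0r.
have Xq0 : A ^+ m * horner_mx A q = 0.
  have := Cayley_Hamilton A; rewrite charA mulrC rmorphM rmorphXn /=.
  by rewrite horner_mx_X.
have ee : e *m e = e.
  have : e * (1 - e) = 0.
    rewrite -wqE /e -rmorphM /=.
    have -> : u * 'X^(m + k) * (w * q) = u * w * 'X^k * ('X^m * q).
      by rewrite exprD; ring.
    by rewrite rmorphM /= [X in _ * X]rmorphM /= rmorphXn /= horner_mx_X Xq0 mulr0.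
  by rewrite mulrBr mulr1 => /subr0_eq.
have tre : \tr e = 0.
  rewrite eE -[u]coefK poly_def rmorph_sum mulr_suml raddf_sum big1 //= => i _.
  rewrite linearZ rmorphXn /= horner_mx_X -scalerAl -exprD mxtraceZ trA ?mulr0 //.
  by rewrite addnA leq_addl.
have e0 : e = 0.
  move: tre; rewrite (mxtrace_idempotent ee) => /eqP.
  by rewrite pnatr_eq0 mxrank_eq0 => /eqP.
exists m; rewrite -[LHS]mulr1 -(subr0 1) -[X in _ - X]e0 -wqE.
rewrite [w * q]mulrC rmorphM mulrA [A ^+ m * _]Xq0 mul0r //.
Qed.

Lemma mul_rV_lin1_linear (F : fieldType) (m n : nat) (f : 'rV[F]_m -> 'rV[F]_n) :
  linear f -> forall u, u *m lin1_mx f = f u.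
Proof.
move=> lf u.
pose f' : {linear 'rV[F]_m -> 'rV[F]_n} :=
  HB.pack f (GRing.isLinear.Build F 'rV[F]_m 'rV[F]_n *:%R f lf).
exact: (mul_rV_lin1 f').
Qed.

Lemma nondegenerate_riesz (F : fieldType) (n : nat)
    (w : 'rV[F]_n -> 'rV[F]_n -> F) (t : 'rV[F]_n -> F) :
  (forall u, scalar (w u)) -> (forall v, scalar (w^~ v)) ->
  (forall u, (forall v, w u v = 0) -> u = 0) -> scalar t ->
  exists h, forall u, t u = w h u.
Proof.
move=> wr wl nd tl.
pose W : 'M[F]_n := \matrix_(i, j) w (delta_mx 0 i) (delta_mx 0 j).
have linS (f : 'rV[F]_n -> F) (u : 'rV[F]_n) : scalar f ->
    f u = \sum_j u 0 j * f (delta_mx 0 j).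
  move=> fl.
  pose f' : {scalar 'rV[F]_n} :=
    HB.pack f (GRing.isLinear.Build F 'rV[F]_n F *%R f fl).
  rewrite {1}(row_sum_delta u) -[f _]/(f' _) linear_sum.
  by apply: eq_bigr => j _; rewrite linearZ.
have wE u v : w u v = (u *m W *m v^T) 0 0.
  rewrite (linS _ v (wr u)) mxE; apply: eq_bigr => j _.
  rewrite !mxE mulrC; congr (_ * _).
  by rewrite (linS _ u (wl _)); apply: eq_bigr => i _; rewrite mxE.
have Wu : W \in unitmx.
  rewrite -row_free_unit; apply: inj_row_free => v vW.
  by apply: nd => u; rewrite wE vW mul0mx mxE.
exists ((\row_j t (delta_mx 0 j)) *m invmx W) => u.
rewrite wE mulmxKV // (linS _ u tl) mxE.
by apply: eq_bigr => j _; rewrite !mxE mulrC.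
Qed.

Section flat_symplectic_algebra.
Context {F : realFieldType} {n : nat}.
Local Notation V := 'rV[F]_n.
Context (p : V -> V -> V) (w : V -> V -> F).
Hypothesis pl : forall v, linear (p^~ v).
Hypothesis pr : forall u, linear (p u).
Hypothesis wr : forall u, scalar (w u).
Hypothesis wl : forall v, scalar (w^~ v).
Hypothesis wA : forall u, w u u = 0.
Hypothesis wnd : forall u, (forall v, w u v = 0) -> u = 0.
Let br u v := p u v - p v u.
Hypothesis lsa : forall x y z, p x (p y z) - p y (p x z) = p (br x y) z.
Hypothesis pE : forall u v z, w (p u v) z = 3^-1 * (w (br u v) z + w (br u z) v).

(* Matrices act on row vectors from the right, so products of operators are
   reversed. *)
Let Rm v : 'M[F]_n := lin1_mx (p^~ v).
Let Lm u : 'M[F]_n := lin1_mx (p u).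

Let RmE u v : u *m Rm v = p u v. Proof. exact: mul_rV_lin1_linear. Qed.
Let LmE u v : v *m Lm u = p u v. Proof. exact: mul_rV_lin1_linear. Qed.

Let p_addl u u' v : p (u + u') v = p u v + p u' v.
Proof. by have := pl v 1 u u'; rewrite !scale1r. Qed.
Let p_addr u v v' : p u (v + v') = p u v + p u v'.
Proof. by have := pr u 1 v v'; rewrite !scale1r. Qed.
Let p_oppl u v : p (- u) v = - p u v.
Proof. by rewrite -!RmE mulNmx. Qed.
Let p_oppr u v : p u (- v) = - p u v.
Proof. by rewrite -!LmE mulNmx. Qed.
Let p_scalel a u v : p (a *: u) v = a *: p u v.
Proof. by rewrite -!RmE scalemxAl. Qed.
Let p_scaler a u v : p u (a *: v) = a *: p u v.
Proof. by rewrite -!LmE scalemxAl. Qed.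
Let w_addl u u' v : w (u + u') v = w u v + w u' v.
Proof. by have := wl v 1 u u'; rewrite scale1r mul1r. Qed.
Let w_addr u v v' : w u (v + v') = w u v + w u v'.
Proof. by have := wr u 1 v v'; rewrite scale1r mul1r. Qed.
Let w_0l v : w 0 v = 0.
Proof. by have := w_addl 0 0 v; rewrite addr0 => /esym/(canRL (addrK _)); rewrite subrr. Qed.
Let w_scalel a u v : w (a *: u) v = a * w u v.
Proof. by have := wl v a u 0; rewrite addr0 w_0l addr0. Qed.
Let w_oppl u v : w (- u) v = - w u v.
Proof. by rewrite -scaleN1r w_scalel mulN1r. Qed.
Let w_anti u v : w u v = - w v u.
Proof.
by have := wA (u + v); rewrite w_addl !w_addr !wA; lra.
Qed.

(** [pE] is symmetric in v and z: L_u lies in sp(omega), which is the infinitesimal form of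
    parallelism of Omega. *)
Let p_sp u v z : w (p u v) z = - w v (p u z).
Proof. by rewrite -w_anti pE (pE u z) addrC. Qed.

(** L_u = R_u^* - R_u for the adjoint with respect to omega. This is where the value 1/3 enters: by
    [p_sp] one of the terms on the right of [pE] repeats the left side. *)
Let p_adj u v z : w (p u v) z = - w (p v u) z + w v (p z u).
Proof.
have := pE u v z; rewrite /br !w_addl !w_oppl (w_anti (p u z)) (w_anti (p z u)).
by have := p_sp u v z; lra.
Qed.

(** Left symmetry, read as an identity between operators in its first argument. *)
Let Rm_p a q : Rm (p a q) = Rm a *m Rm q - Lm a *m Rm q + Rm q *m Lm a.
Proof.
apply/row_matrixP => i; rewrite !rowE mulmxDr mulmxBr !mulmxA !RmE !LmE.
have := lsa (delta_mx 0 i) a q; rewrite /br p_addl p_oppl => /(canRL (subrK _)) ->.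
by rewrite addrC.
Qed.

Let tr_Rm_p a q : \tr (Rm (p a q)) = \tr (Rm a *m Rm q).
Proof.
by rewrite Rm_p mxtraceD linearB /= (mxtrace_mulC (Lm a)) subrK.
Qed.

Let Rm_scalar : scalar (fun u => \tr (Rm u)).
Proof.
move=> a u v; rewrite -mxtraceZ -mxtraceD; congr (\tr _).
by apply/row_matrixP => i; rewrite !rowE mulmxDr -scalemxAr !RmE p_addr p_scaler.
Qed.

Section trace_form.
Context (h : V).
Hypothesis hE : forall u, \tr (Rm u) = w h u.

(** By [p_sp] both sides equal - tr (R_u R_v). *)
Let N_sp u v : w (p u h) v = - w u (p v h).
Proof.
rewrite p_sp -hE tr_Rm_p mxtrace_mulC -tr_Rm_p hE (w_anti u).
by rewrite opprK p_sp.
Qed.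

(** [p_adj] says L_h = R_h^* - R_h, and R_h^* = - R_h by [N_sp]. *)
Let p_h v : p h v = - 2 *: p v h.
Proof.
apply/eqP; rewrite -subr_eq0; apply/eqP/wnd => z.
rewrite w_addl w_oppl w_scalel p_adj; have := N_sp v z; lra.
Qed.

(* Flatness and the definition of the product express L_[h,a] as -2 and -3 times
   the commutator of R_h and L_a, which therefore vanishes. *)
Let N_comm a v : p a (p v h) = p (p a v) h.
Proof.
apply/eqP; rewrite -subr_eq0; apply/eqP/wnd => z.
pose M x := p x h.
have brh x : br h x = - 3 *: M x.
  by rewrite /br p_h -[X in _ - X]scale1r -scalerBl; congr (_ *: _); lra.
have e1 : w (p (br h a) v) z = -2 * w (M (p a v) - p a (M v)) z.
  rewrite -lsa p_h p_h p_scaler -scalerBr w_scalel //.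
(* The Jacobi identity, a consequence of left symmetry, combined with [h, x] = -3 R_h x. *)
have jac x : br (br h a) x = - 3 *: M (br a x) + 3 *: br a (M x).
  have -> : br (br h a) x = br h (br a x) - br a (br h x).
    rewrite /br.
    have l1 := lsa h a x; have l2 := lsa h x a; have l3 := lsa a x h.
    rewrite /br !p_addl !p_oppl in l1 l2 l3.
    rewrite !p_addl !p_addr !p_oppl !p_oppr.
    move: l1 l2 l3 => /(canRL (subrK _)) -> /(canRL (subrK _)) -> /(canRL (subrK _)) ->.
    apply/rowP => j; rewrite !mxE; lra.
  rewrite !brh; congr (_ + _).
  rewrite /br p_scaler p_scalel -scalerBr -scaleNr; congr (_ *: _); lra.
have e2 : 3 * w (p (br h a) v) z = -9 * w (M (p a v) - p a (M v)) z.
  rewrite pE !jac /M; have := N_sp (br a v) z; have := N_sp (br a z) v; have := N_sp (p a v) z.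
  have := pE a v (M z); have := pE a (M v) z; rewrite /M.
  move: (br a v) (br a z) (br a (p v h)) (br a (p z h)) => b1 b2 b3 b4.
  rewrite !w_addl !w_scalel w_oppl; lra.
have : w (M (p a v) - p a (M v)) z = 0 by lra.
by rewrite -(opprB (p a (p v h))) w_oppl => /eqP; rewrite oppr_eq0 => /eqP.
Qed.

(** R_h and L_x are commuting elements of sp(omega), so their product is self-adjoint for omega and
    the associated bilinear form is alternating. *)
Let form_vv x v : w (p (p x v) h) v = 0.
Proof.
have e1 : w (p (p x v) h) v = - w (p v h) (p x v) by rewrite -N_comm p_sp.
by have := N_sp v (p x v); have := w_anti (p (p x v) h) v; lra.
Qed.

(** The trace equals tr R_u for u = (x.v).v with x = R_v^k v, and symmetry of the trace form brings
    omega(h, u) to the shape of [form_vv]. Three is the first exponent for which u has this form. *)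
Lemma tr_Rm_iter v k : \tr (Rm v ^+ k.+3) = 0.
Proof.
set A := Rm v.
(* One factor A at a time is moved out of R by [Rm_p]; its two terms with L_a cancel under the trace
   because A commutes with its powers. *)
have key j i : \tr (A ^+ j *m Rm (v *m A ^+ i)) = \tr (A ^+ (j + i).+1).
  elim: i j => [|i IH] j; first by rewrite addn0 expr0 mulmx1 exprSr.
  rewrite addnS -addSn -IH exprSr exprS [v *m _]mulmxA RmE Rm_p -/A.
  set a := v *m _; rewrite mulmxDr mulmxBr mxtraceD linearB /= !mulmxA.
  rewrite (mxtrace_mulC _ A) (mxtrace_mulC (_ *m Lm a) A) !mulmxA.
  by have -> : A ^+ j *m A = A *m A ^+ j; rewrite -?[_ *m _]/(_ * _) -?exprS -?exprSr ?subrK.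
have := key 0%N k.+2; rewrite expr0 mul1mx add0n => <-.
rewrite hE exprSr [v *m _]mulmxA RmE exprSr [v *m _]mulmxA RmE.
rewrite -hE tr_Rm_p mxtrace_mulC -tr_Rm_p hE.
have := p_sp v h (p (v *m A ^+ k) v).
have := form_vv (v *m A ^+ k) v; have := N_sp v (p (v *m A ^+ k) v).
by have := w_anti v (p (p (v *m A ^+ k) v) h); lra.
Qed.

End trace_form.

Lemma nilpotent_right_mul v : exists m, (lin1_mx (p^~ v) : 'M[F]_n) ^+ m = 0.
Proof.
have [h hE] := nondegenerate_riesz wr wl wnd Rm_scalar.
have : forall j, (3 <= j)%N -> \tr ((lin1_mx (p^~ v) : 'M[F]_n) ^+ j) = 0.
  by move=> [|[|[|j]]] // _; apply: (tr_Rm_iter hE).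
move: (lin1_mx _ : 'M[F]_n); case: n => [|n'] A trA.
  by exists 0%N; exact: flatmx0.
exact: nilpotent_of_mxtrace trA.
Qed.
End flat_symplectic_algebra.

(** * Ordinary differential equations *)

Lemma is_derive_continuous (R : realType) (V : normedModType R) (f : R -> V) t df :
  is_derive (t : R) 1 f df -> {for t, continuous f}.
Proof.
by case=> df1 _; apply: differentiable_continuous; exact/derivable1_diffP.
Qed.

Lemma is_derive_mxP (R : realType) (V : normedModType R) (m n : nat)
    (f : V -> 'M[R]_(m, n)) t v df :
  is_derive t v f df <-> forall i j, is_derive t v (fun s => f s i j) (df i j).
Proof.
split=> [[dv <-] i j|H].
  by split; [exact: (derivable_mxP _ _ _).1|rewrite derive_mx// mxE].
have dv : derivable f t v by apply/derivable_mxP => i j; case: (H i j).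
split => //; apply/matrixP => i j; rewrite derive_mx// mxE.
by case: (H i j).
Qed.

Lemma mx_norm_coord (R : realType) (m n : nat) (v : 'M[R]_(m, n)) i j : `|v i j| <= `|v|.
Proof.
rewrite [leRHS]/Num.Def.normr/= mx_normrE.
exact: (le_bigmax _ (fun ij : 'I_m * 'I_n => `|v ij.1 ij.2|) (i, j)).
Qed.

Lemma mx_norm_le (R : realType) (m n : nat) (v : 'M[R]_(m, n)) e :
  0 <= e -> (forall i j, `|v i j| <= e) -> `|v| <= e.
Proof.
move=> e0 H; rewrite [leLHS]/Num.Def.normr/= mx_normrE.
by apply: bigmax_le => // -[i j] _.
Qed.

(** Integrals need a fixed lower end, so primitives on the windows |t| < N are built separately and
    normalized at 0; any two of them then agree on the smaller window. *)
Lemma continuous_antiderivative (R : realType) (f : R -> R) :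
  continuous f -> exists F : R -> R, F 0 = 0 /\ forall t : R, is_derive t 1 F (f t).
Proof.
move=> cf.
have FN (N : nat) : exists F : R -> R, forall t : R, `|t| < N%:R -> is_derive t 1 F (f t).
  pose mu := @lebesgue_measure R.
  exists (fun x => \int[mu]_(t in [set` `[- N%:R : R, x]]) f t)%R => t.
  rewrite ltr_norml => /andP[t1 t2].
  have [|d1 d2] := @continuous_FTC1_closed R f (- N%:R) t N%:R t2 _ t1 (cf t).
    apply: continuous_compact_integrable => //; first exact: segment_compact.
    exact: continuous_subspaceT.
  by split; [exact: d1|rewrite -derive1E].
have {FN} [G GE] := choice FN.
pose N (t : R) := (Num.truncn `|t|).+1.
have NE t : `|t| < (N t)%:R by rewrite truncnS_gt.
pose F t := G (N t) t - G (N t) 0.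
have FE M t : `|t| < M%:R -> F t = G M t - G M 0.
  move=> tM; rewrite /F.
  pose D s := G (N t) s - G M s.
  suff : D t = D 0 by rewrite /D; lra.
  apply/eqP; rewrite -subr_eq0; apply/eqP.
  have key a b : a <= b -> `|a| <= `|t| -> `|b| <= `|t| -> D b - D a = 0.
    move=> ab a0 b0.
    have dD x : x \in `[a, b] -> is_derive x 1 D 0.
      rewrite in_itv /= => /andP[ax xb].
      have xt : `|x| <= `|t|.
        rewrite ler_norml (le_trans _ ax) ?(le_trans xb) ?(le_trans (ler_norm _) b0)//.
        by move: a0; rewrite ler_norml => /andP[].
      rewrite -(subrr (f x)).
      by apply: is_deriveB; apply: GE; exact: le_lt_trans xt _.
    have dD' x : x \in `]a, b[ -> is_derive x 1 D ((fun=> 0) x).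
      by move=> xab; apply: dD; exact: subset_itv_oo_cc xab.
    have cD : {within `[a, b], continuous D}.
      apply: continuous_in_subspaceT => x; rewrite inE /= => xab.
      exact: is_derive_continuous (dD x xab).
    have [c _] := MVT_segment ab dD' cD.
    by rewrite mul0r.
  have [t0|t0] := leP 0 t; first by apply: key => //; rewrite normr0.
  have := key t 0 (ltW t0); rewrite normr0 lexx normr_ge0 => /(_ isT isT) H.
  by rewrite -opprB H oppr0.
exists F; split; first by rewrite /F subrr.
move=> t; pose M := (N t).+1.
have tM : `|t| < M%:R by rewrite (lt_le_trans (NE t))// ler_nat.
have : is_derive t 1 (fun s => G M s - G M 0) (f t).
  rewrite -[f t]subr0; apply: is_deriveB; exact: GE.
apply: near_eq_is_derive; near=> s; rewrite (FE M) //.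
near: s; apply: (cvgr_norm_lt t) => //; exact: cvg_id.
Unshelve. all: by end_near. Qed.

(** The intervals of center x_k and radius 2 C / 2^k, the tail of the geometric series, are nested;
    the supremum of their left ends lies in all of them. *)
Lemma geometric_cauchy_limit (R : realType) (x : nat -> R) (C : R) :
  (forall k, `|x k.+1 - x k| <= C / 2 ^+ k) ->
  exists l, forall k, `|l - x k| <= 2 * C / 2 ^+ k.
Proof.
move=> xC.
have C0 k : 0 <= C / 2 ^+ k by exact: le_trans (xC k).
pose y k := x k - 2 * (C / 2 ^+ k); pose z k := x k + 2 * (C / 2 ^+ k).
have half k : C / 2 ^+ k = 2 * (C / 2 ^+ k.+1).
  by rewrite exprS; field; rewrite expf_neq0.
have yS k : y k <= y k.+1.
  by move: (xC k); rewrite /y half ler_norml => /andP[]; lra.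
have zS k : z k.+1 <= z k.
  by move: (xC k); rewrite /z half ler_norml => /andP[]; lra.
have yz k : y k <= z k by move: (C0 k); rewrite /y /z; lra.
have ym i j : y i <= z j.
  have yn a b : y a <= y (a + b)%N.
    by elim: b => [|b IH]; rewrite ?addn0 // addnS (le_trans IH).
  have zn a b : z (a + b)%N <= z a.
    by elim: b => [|b IH]; rewrite ?addn0 // addnS (le_trans _ IH).
  by rewrite (le_trans (yn i j))// (le_trans (yz _))// addnC.
exists (sup (range y)) => k.
have h1 : y k <= sup (range y).
  by apply: ub_le_sup; [exists (z k) => _ [i _ <-]; exact: ym|exists k].
have h2 : sup (range y) <= z k.
  by apply: ge_sup; [exists (y 0%N), 0%N|move=> _ [i _ <-]; exact: ym].
by rewrite ler_norml -mulrA; move: h1 h2; rewrite /y /z => h1 h2; apply/andP; split; lra.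
Qed.

Section weighted_norm.
Context {R : realType}.
Context {lam Lam : R -> R}.
Hypothesis lam0 : forall t, 0 <= lam t.
Hypothesis Lam0 : Lam 0 = 0.
Hypothesis LamE : forall t : R, is_derive t 1 Lam (lam t).

(* For the sup norm with this weight, integrating a function bounded by lam times
   another one halves the norm. *)
Let weight t := expR (2 * `|Lam t|).

Let Lam_homo a b : a <= b -> Lam a <= Lam b.
Proof.
move=> ab; apply: (@ger0_derive1_ndecr R Lam a b) => //.
- by move=> x _; rewrite derive1E (@derive_val _ _ _ _ _ _ _ (LamE x)).
- apply: continuous_subspaceT => x; exact: is_derive_continuous (LamE x).
Qed.

Lemma weight_continuous : continuous weight.
Proof.
move=> t; apply: continuous_comp; last exact: continuous_expR.
apply: continuousM; first exact: cst_continuous.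
by apply: continuous_comp; [exact: is_derive_continuous (LamE t)|exact: norm_continuous].
Qed.

(** With c = 2 for t >= 0 and c = -2 for t <= 0, c Lam equals 2 |Lam| and [D / 2 * expR (c * Lam s)]
    has derivative D lam weight up to sign. Its difference with f is therefore monotone on each side
    of 0, starting from D / 2 >= 0. *)
Let weighted_bound_one_side (f df : R -> R) (T D : R) : 0 <= D -> f 0 = 0 ->
  (forall t : R, `|t| <= T -> is_derive t 1 f (df t)) ->
  (forall t, `|t| <= T -> `|df t| <= D * (lam t * weight t)) ->
  forall t, `|t| <= T -> f t <= D / 2 * weight t.
Proof.
move=> D0 f0 dfE dfD t tT.
have dexp : forall c s : R, `|s| <= T ->
    is_derive s 1 (fun s => D / 2 * expR (c * Lam s) - f s : R)
      (D / 2 * (expR (c * Lam s) * (c * lam s)) - df s).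
  move=> c s sT; apply: is_deriveB; last exact: dfE sT.
have sT s : `|s| <= `|t| -> `|s| <= T by move/le_trans; apply.
have [t0|/ltW t0] := leP 0 t.
- have Ls s : 0 <= s -> `|Lam s| = Lam s.
    by move=> s0; rewrite ger0_norm// -Lam0 Lam_homo.
  pose g s := D / 2 * expR (2 * Lam s) - f s.
  have in_sT s : s \in `]0, t[ -> 0 <= s /\ `|s| <= T.
    rewrite in_itv /= => /andP[s0 st]; split; first exact: ltW.
    by apply: sT; rewrite !ger0_norm// ltW.
  have : g 0 <= g t.
    have d1 s : s \in `]0, t[ -> derivable g s 1.
      by move=> /in_sT[_ /(dexp 2)[]].
    have d2 s : s \in `]0, t[ -> 0 <= derive1 g s.
      move=> /in_sT[s0 ssT]; rewrite derive1E; have [_ ->] := dexp 2 s ssT.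
      have := dfD _ ssT; rewrite /weight Ls// ler_norml => /andP[_].
      rewrite subr_ge0; move/le_trans; apply; rewrite le_eqVlt; apply/orP; left.
      by apply/eqP; field.
    have d3 : {within `[0, t], continuous g}.
      apply: continuous_in_subspaceT => s; rewrite inE /= in_itv /= => /andP[s0 st].
      apply: (is_derive_continuous (dexp 2 s _)).
      by apply: sT; rewrite !ger0_norm.
    exact: (ger0_derive1_ndecr d1 d2 d3 (lexx 0) t0 (lexx t)).
  rewrite /g /weight Ls// f0 subr0 Lam0 mulr0 expR0 mulr1 => h.
  by rewrite -subr_ge0 (le_trans _ h)// divr_ge0.
- have Ls s : s <= 0 -> `|Lam s| = - Lam s.
    by move=> s0; rewrite ler0_norm// -Lam0 Lam_homo.
  pose g s := D / 2 * expR (-2 * Lam s) - f s.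
  have in_sT s : s \in `]t, 0[ -> s <= 0 /\ `|s| <= T.
    rewrite in_itv /= => /andP[ts s0]; split; first exact: ltW.
    by apply: sT; rewrite !ler0_norm ?lerN2// ltW.
  have : g 0 <= g t.
    have d1 s : s \in `]t, 0[ -> derivable g s 1.
      by move=> /in_sT[_ /(dexp (-2))[]].
    have d2 s : s \in `]t, 0[ -> derive1 g s <= 0.
      move=> /in_sT[s0 ssT]; rewrite derive1E; have [_ ->] := dexp (-2) s ssT.
      have := dfD _ ssT; rewrite /weight Ls// ler_norml => /andP[h _].
      rewrite subr_le0 (le_trans _ h)// le_eqVlt; apply/orP; left.
      by apply/eqP; rewrite mulrN -mulNr; field.
    have d3 : {within `[t, 0], continuous g}.
      apply: continuous_in_subspaceT => s; rewrite inE /= in_itv /= => /andP[ts s0].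
      apply: (is_derive_continuous (dexp (-2) s _)).
      by apply: sT; rewrite !ler0_norm// lerN2.
    exact: (ler0_derive1_nincr d1 d2 d3 (lexx t) t0 (lexx 0)).
  rewrite /g /weight Ls// f0 subr0 Lam0 mulr0 expR0 mulr1 => h.
  by rewrite mulrN -mulNr -subr_ge0 (le_trans _ h)// divr_ge0.
Qed.

Lemma weighted_bound (m n : nat) (v dv : R -> 'M[R]_(m, n)) (T D : R) : 0 <= D -> v 0 = 0 ->
  (forall t : R, `|t| <= T -> is_derive t 1 v (dv t)) ->
  (forall t, `|t| <= T -> `|dv t| <= D * (lam t * weight t)) ->
  forall t, `|t| <= T -> `|v t| <= D / 2 * weight t.
Proof.
move=> D0 v0 dvE dvD t tT.
apply: mx_norm_le => [|i j]; first by rewrite mulr_ge0 ?expR_ge0// divr_ge0.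
have dj : forall s : R, `|s| <= T -> is_derive s 1 (fun s => v s i j) (dv s i j).
  by move=> s /dvE /is_derive_mxP.
have bj s : `|s| <= T -> `|dv s i j| <= D * (lam s * weight s).
  by move=> sT; exact: le_trans (mx_norm_coord _ _ _) (dvD _ sT).
rewrite ler_norml lerNl; apply/andP; split.
- apply: (@weighted_bound_one_side (fun s => - v s i j) (fun s => - dv s i j) T) => //.
  + by rewrite v0 mxE oppr0.
  + by move=> s sT; apply: is_deriveN; exact: dj.
  + by move=> s sT; rewrite normrN bj.
- by apply: (@weighted_bound_one_side (fun s => v s i j) (fun s => dv s i j) T);
    rewrite // v0 mxE.
Qed.

End weighted_norm.

Lemma le0_of_halving (R : realType) (x C : R) :
  (forall k, x <= C / 2 ^+ k) -> x <= 0.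
Proof.
move=> H; rewrite leNgt; apply/negP => x0.
pose k := Num.truncn (C / x).
have : C / x < 2 ^+ k.
  by rewrite (lt_le_trans (truncnS_gt _))// -natrX ler_nat ltn_expl.
rewrite ltr_pdivrMr// => h; have := H k.
by rewrite ler_pdivlMr ?exprn_gt0// mulrC leNgt h.
Qed.

(** The limit is chosen before the constant C, so that a limit function can be fixed pointwise while
    C still varies with the time segment considered. A sequence without any such C gets the limit
    0. *)
Lemma mx_geometric_cauchy_limit (R : realType) (m n : nat) (x : nat -> 'M[R]_(m, n)) :
  exists l, forall C, (forall k, `|x k.+1 - x k| <= C / 2 ^+ k) ->
  forall k, `|l - x k| <= 2 * C / 2 ^+ k.
Proof.
have real_limit (y : nat -> R) : exists l, forall C,
    (forall k, `|y k.+1 - y k| <= C / 2 ^+ k) -> forall k, `|l - y k| <= 2 * C / 2 ^+ k.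
  have [[C yC]|noC] :=
      pselect (exists C, forall k, `|y k.+1 - y k| <= C / 2 ^+ k); last first.
    by exists 0 => C yC; case: noC; exists C.
  have [l lE] := geometric_cauchy_limit yC.
  exists l => C' /geometric_cauchy_limit[l' l'E].
  suff -> : l = l' by [].
  apply/eqP; rewrite -subr_eq0 -normr_le0.
  apply: (@le0_of_halving _ _ (2 * C + 2 * C')) => k.
  have -> : l - l' = (l - y k) - (l' - y k) by ring.
  by rewrite (le_trans (ler_normB _ _))// mulrDl lerD.
have [l lE] := choice (fun ij : 'I_m * 'I_n => real_limit (fun k => x k ij.1 ij.2)).
exists (\matrix_(i, j) l (i, j)) => C xC k.
have C0 : 0 <= C by have := le_trans (normr_ge0 _) (xC 0%N); rewrite divr1.
apply: mx_norm_le => [|i j]; first by rewrite divr_ge0 ?exprn_ge0// mulr_ge0.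
rewrite !mxE; apply: lE => a; apply: le_trans (xC a).
by have := mx_norm_coord (x a.+1 - x a) i j; rewrite !mxE.
Qed.

Lemma continuous_bounded_segment (R : realType) (V : normedModType R) (f : R -> V) (T : R) :
  0 <= T -> (forall t, `|t| <= T -> {for t, continuous f}) ->
  exists2 D, 0 <= D & forall t, `|t| <= T -> `|f t| <= D.
Proof.
move=> T0 cf.
have TT : - T <= T by lra.
have cn : {within `[- T, T], continuous (fun t => `|f t|)}.
  apply: continuous_in_subspaceT => s; rewrite inE /= in_itv /= -ler_norml => sT.
  by apply: continuous_comp; [exact: cf|exact: norm_continuous].
have [c _ cmax] := EVT_max TT cn.
exists `|f c| => // t tT; apply: cmax.
by rewrite in_itv /= -ler_norml.
Qed.

Lemma weight_ge1 (R : realType) (x : R) : 1 <= expR (2 * `|x|).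
Proof. by rewrite -expR0 ler_expR mulr_ge0. Qed.

(** Applied to v itself, [weighted_bound] halves any bound of v by a multiple of the weight.
    Iterating from a bound on the compact segment leaves only 0. *)
Lemma gronwall_unique (R : realType) (lam Lam : R -> R) (m n : nat)
    (v dv : R -> 'M[R]_(m, n)) (T : R) :
  (forall t, 0 <= lam t) -> Lam 0 = 0 -> (forall t : R, is_derive t 1 Lam (lam t)) ->
  0 <= T -> v 0 = 0 -> (forall t : R, `|t| <= T -> is_derive t 1 v (dv t)) ->
  (forall t, `|t| <= T -> `|dv t| <= lam t * `|v t|) ->
  forall t, `|t| <= T -> v t = 0.
Proof.
move=> lam0 Lam0 LamE T0 v0 dvE dvD.
have [D D0 vD] := continuous_bounded_segment T0 (fun t tT => is_derive_continuous (dvE t tT)).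
have key k : forall t, `|t| <= T -> `|v t| <= D / 2 ^+ k * expR (2 * `|Lam t|).
  elim: k => [t tT|k IH].
    by rewrite expr0 divr1 (le_trans (vD t tT))// ler_peMr// weight_ge1.
  have DD : D / 2 ^+ k.+1 = D / 2 ^+ k / 2.
    by rewrite exprSr; field; rewrite expf_neq0.
  rewrite DD; apply: (weighted_bound lam0 Lam0 LamE _ v0 dvE).
    by rewrite divr_ge0// exprn_ge0.
  move=> t tT; rewrite (le_trans (dvD t tT))// mulrCA ler_wpM2l//; exact: IH.
move=> t tT; apply/eqP; rewrite -normr_le0.
apply: (@le0_of_halving _ _ (D * expR (2 * `|Lam t|))) => k.
by rewrite mulrAC key.
Qed.

Lemma mx_continuous_antiderivative (R : realType) (m n : nat) (f : R -> 'M[R]_(m, n)) :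
  continuous f -> exists F : R -> 'M[R]_(m, n), F 0 = 0 /\ forall t : R, is_derive t 1 F (f t).
Proof.
move=> cf.
have cfij (ij : 'I_m * 'I_n) : continuous (fun t => f t ij.1 ij.2).
  move=> t; apply: (@continuous_comp _ _ _ f (fun M : 'M[R]_(m, n) => M ij.1 ij.2)).
    exact: cf.
  exact: coord_continuous.
have [F FE] := choice (fun ij => continuous_antiderivative (cfij ij)).
exists (fun t => \matrix_(i, j) F (i, j) t); split.
  by apply/matrixP => i j; rewrite !mxE; case: (FE (i, j)).
move=> t; apply/is_derive_mxP => i j.
have -> : (fun s : R => (\matrix_(i, j) F (i, j) s) i j) = F (i, j).
  by apply/funext => s; rewrite mxE.
by case: (FE (i, j)).
Qed.

(** In the weighted norm the Picard map halves distances on every segment |t| <= T, whatever the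
    size of lam there. The iterates thus converge on the whole line, and no continuation of local
    solutions is needed. *)
Theorem picard_lindelof (R : realType) (m n : nat) (f : R -> 'M[R]_(m, n) -> 'M[R]_(m, n))
    (lam : R -> R) :
  continuous lam -> (forall t, 0 <= lam t) ->
  (forall t u w, `|f t u - f t w| <= lam t * `|u - w|) ->
  (forall u : R -> 'M[R]_(m, n), continuous u -> continuous (fun t => f t (u t))) ->
  forall u0, exists u, u 0 = u0 /\ forall t : R, is_derive t 1 u (f t (u t)).
Proof.
move=> clam lam0 flip cf u0.
have [Lam [Lam0 LamE]] := continuous_antiderivative clam.
pose wt t := expR (2 * `|Lam t|).
have wt1 t : 1 <= wt t by exact: weight_ge1.
have wt0 t : 0 <= wt t by exact: expR_ge0.
(* The implication sits inside the existential so that choice gives an operator P on all functions;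
   on discontinuous ones it is arbitrary. *)
have exP (g : R -> 'M[R]_(m, n)) : exists F : R -> 'M[R]_(m, n), continuous g ->
    F 0 = 0 /\ forall t : R, is_derive t 1 F (g t).
  have [cg|ncg] := pselect (continuous g); last by exists (fun=> 0).
  by have [F FE] := mx_continuous_antiderivative cg; exists F.
have [P PE] := choice exP.
pose next u t := u0 + P (fun s => f s (u s)) t.
have next0 u : continuous u -> next u 0 = u0.
  by move=> cu; rewrite /next (PE _ (cf u cu)).1 addr0.
have nextE u : continuous u -> forall t : R, is_derive t 1 (next u) (f t (u t)).
  move=> cu t; rewrite -[f t (u t)]add0r; apply: is_deriveD.
  exact: (PE _ (cf u cu)).2.
pose u k := iter k next (fun=> u0).
have cu k : continuous (u k).
  elim: k => [t|k IH t]; first exact: cst_continuous.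
  exact: is_derive_continuous (nextE _ IH t).
have step v w T D : continuous v -> continuous w -> 0 <= D ->
    (forall t, `|t| <= T -> `|v t - w t| <= D * wt t) ->
    forall t, `|t| <= T -> `|next v t - next w t| <= D / 2 * wt t.
  move=> cv cw D0 vw.
  apply: (@weighted_bound _ lam Lam lam0 Lam0 LamE _ _ (fun t => next v t - next w t)
    (fun t => f t (v t) - f t (w t))) => //.
  - by rewrite !next0// subrr.
  - by move=> t _; apply: is_deriveB; exact: nextE.
  - move=> t tT; rewrite (le_trans (flip _ _ _))// mulrCA ler_wpM2l//; exact: vw.
have cauchy T : 0 <= T -> exists2 D, 0 <= D & forall k t, `|t| <= T ->
    `|u k.+1 t - u k t| <= D / 2 ^+ k * wt t.
  move=> T0.
  have c10 t : `|t| <= T -> {for t, continuous (fun t => u 1%N t - u 0%N t)}.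
    by move=> _; apply: continuousB; exact: cu.
  have [D D0 vD] := continuous_bounded_segment T0 c10.
  exists D => //; elim => [t tT|k IH].
    by rewrite expr0 divr1 (le_trans (vD t tT))// ler_peMr.
  have DD : D / 2 ^+ k.+1 = D / 2 ^+ k / 2.
    by rewrite exprSr; field; rewrite expf_neq0.
  by rewrite DD; apply: (step _ _ _ _ (cu _) (cu _) _ IH); rewrite divr_ge0// exprn_ge0.
have [U UE] := choice (fun t => mx_geometric_cauchy_limit (fun k => u k t)).
have Uu T : 0 <= T -> exists2 D, 0 <= D & forall k t, `|t| <= T ->
    `|U t - u k t| <= D / 2 ^+ k * wt t.
  move=> /cauchy[D D0 DE]; exists (2 * D) => [|k t tT]; first exact: mulr_ge0.
  have -> : 2 * D / 2 ^+ k * wt t = 2 * (D * wt t) / 2 ^+ k by rewrite -!mulrA [_ * wt t]mulrC.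
  by apply: UE => i; rewrite mulrAC; exact: DE.
have cU : continuous U.
  move=> t; apply/cvgrPdist_lt => e e0.
  have [D D0 DE] := Uu (`|t| + 1) (addr_ge0 (normr_ge0 _) ler01).
  pose W := wt t + 1.
  have W0 : 0 < W by rewrite ltr_wpDl.
  have [k kE] : exists k, D / 2 ^+ k * W < e / 3.
    apply/not_existsP => H.
    have : e / 3 <= 0.
      apply: (@le0_of_halving _ _ (D * W)) => k.
      by rewrite mulrAC leNgt; apply/negP/H.
    by rewrite leNgt divr_gt0.
  near=> s.
  have sT : `|s| <= `|t| + 1.
    by near: s; apply: (cvgr_norm_le t); [exact: cvg_id|rewrite ltrDl].
  have sW : wt s <= W.
    near: s; apply: (cvgr_le (wt t)); last by rewrite ltrDl.
    exact: (weight_continuous LamE).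
  have us : `|u k t - u k s| < e / 3.
    by near: s; move: (cu k t) => /cvgrPdist_lt; apply; rewrite divr_gt0.
  have tT : `|t| <= `|t| + 1 by rewrite lerDl.
  have Ut : `|U t - u k t| < e / 3.
    apply: le_lt_trans (DE k t tT) _; apply: le_lt_trans kE.
    by rewrite ler_wpM2l ?divr_ge0 ?exprn_ge0// lerDl.
  have Us : `|U s - u k s| < e / 3.
    apply: le_lt_trans (DE k s sT) _; apply: le_lt_trans kE.
    by rewrite ler_wpM2l ?divr_ge0 ?exprn_ge0.
  have -> : U t - U s = (U t - u k t) + (u k t - u k s) - (U s - u k s).
    by rewrite opprB !addrA subrK subrK.
  apply: le_lt_trans (ler_normB _ _) _; have := ler_normD (U t - u k t) (u k t - u k s).
  lra.
have fixU t : next U t = U t.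
  have [D D0 DE] := Uu `|t| (normr_ge0 t).
  apply/eqP; rewrite -subr_eq0 -normr_le0.
  apply: (@le0_of_halving _ _ (D * wt t)) => k.
  have -> : next U t - U t = (next U t - u k.+1 t) - (U t - u k.+1 t).
    by rewrite opprB addrA subrK.
  have h1 : `|next U t - u k.+1 t| <= D / 2 ^+ k / 2 * wt t.
    apply: (step U (u k) `|t| _ cU (cu k) _ (DE k)) => //.
    by rewrite divr_ge0// exprn_ge0.
  have h2 := DE k.+1 t (lexx _).
  apply: le_trans (ler_normB _ _) _; apply: le_trans (lerD h1 h2) _.
  rewrite le_eqVlt; apply/orP; left; apply/eqP.
  by rewrite exprS; field; rewrite expf_neq0.
exists U; split; first by rewrite -fixU next0.
have nextU : next U = U by apply/funext => s; rewrite fixU.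
by move=> t; have := nextE U cU t; rewrite nextU.
Unshelve. all: by end_near. Qed.

(** * The flow of a left symmetric algebra *)

Lemma linear_sum_coord (F : fieldType) (n : nat) (W : lmodType F) (f : 'rV[F]_n -> W) u :
  linear f -> f u = \sum_j u 0 j *: f (delta_mx 0 j).
Proof.
move=> fl.
pose f' : {linear 'rV[F]_n -> W} :=
  HB.pack f (GRing.isLinear.Build F 'rV[F]_n W *:%R f fl).
rewrite {1}(row_sum_delta u) -[f _]/(f' _) linear_sum.
by apply: eq_bigr => j _; rewrite linearZ.
Qed.

Lemma is_derive_scale_row (R : realType) (m n : nat) (k : R -> R) (g : R -> 'M[R]_(m, n))
    (t : R) dk dg :
  is_derive t 1 k dk -> is_derive t 1 g dg ->
  is_derive t 1 (fun s => k s *: g s) (k t *: dg + dk *: g t).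
Proof.
move=> kE gE; apply/is_derive_mxP => i j; rewrite !mxE.
have /is_derive_mxP/(_ i j) gij := gE.
have -> : (fun s => (k s *: g s) i j) = (k * (fun s => g s i j)).
  by apply/funext => s; rewrite mxE.
have := is_deriveM kE gij; rewrite /GRing.scale /= => H.
by rewrite [dk * _]mulrC.
Qed.

Lemma is_derive_line (R : realType) (n : nat) (z a : 'rV[R]_n) (t : R) :
  is_derive t 1 (fun s => z + s *: a) a.
Proof.
rewrite -[X in is_derive _ _ _ X]add0r; apply: is_deriveD.
have := is_derive_scale_row (is_derive_id t 1) (is_derive_cst a t 1).
by rewrite scaler0 add0r scale1r.
Qed.

(** Product rule for a family of linear maps whose derivative is known only with the argument held
    fixed. Expanding the argument in the standard basis reduces it to finitely many such
    derivatives. *)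
Lemma is_derive_frozen (R : realType) (n m p : nat) (G : R -> 'rV[R]_n -> 'M[R]_(m, p))
    (dG : 'rV[R]_n -> 'M[R]_(m, p)) (w : R -> 'rV[R]_n) (dw : 'rV[R]_n) (t : R) :
  (forall s, linear (G s)) -> (forall u, is_derive t 1 (G^~ u) (dG u)) ->
  is_derive t 1 w dw ->
  is_derive t 1 (fun s => G s (w s)) (dG (w t) + G t dw).
Proof.
move=> lG GE wE.
have expand (w' : R -> 'rV[R]_n) dw' : is_derive t 1 w' dw' ->
    is_derive t 1 (fun s => G s (w' s))
      (\sum_l w' t 0 l *: dG (delta_mx 0 l) + G t dw').
  move=> w'E; rewrite [G t dw']linear_sum_coord// -big_split /=.
  have -> : (fun s => G s (w' s)) =
      \sum_(l < n) (fun s => w' s 0 l *: G s (delta_mx 0 l)).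
    by apply/funext => s; rewrite (linear_sum_coord _ (lG s)) fct_sumE.
  have H l : is_derive t 1 (fun s => w' s 0 l *: G s (delta_mx 0 l))
      (w' t 0 l *: dG (delta_mx 0 l) + dw' 0 l *: G t (delta_mx 0 l)).
    have kl : is_derive t 1 (fun s => w' s 0 l) (dw' 0 l) by move/is_derive_mxP : w'E.
    exact: is_derive_scale_row kl (GE _).
  exact: is_derive_sum.
(* [dG] is not assumed linear: its expansion follows by applying [expand] to the constant curve and
   comparing derivatives. *)
have -> : dG (w t) = \sum_l w t 0 l *: dG (delta_mx 0 l).
  have h := expand (cst (w t)) 0 (is_derive_cst _ _ _).
  have G0 : G t 0 = 0 by rewrite (linear_sum_coord _ (lG t)) big1// => j _; rewrite mxE scale0r.
  have [_ h1] := h; have [_ h2] := GE (w t).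
  by rewrite -h2 -[LHS]/('D_1 (fun s => G s (cst (w t) s)) t) h1 G0 addr0.
exact: expand.
Qed.

Lemma is_derive_bilinear (R : realType) (n m p q : nat)
    (b : 'rV[R]_n -> 'rV[R]_m -> 'M[R]_(p, q)) (f : R -> 'rV[R]_n) (g : R -> 'rV[R]_m)
    (t : R) df dg :
  (forall u, linear (b u)) -> (forall v, linear (b^~ v)) ->
  is_derive t 1 f df -> is_derive t 1 g dg ->
  is_derive t 1 (fun s => b (f s) (g s)) (b df (g t) + b (f t) dg).
Proof.
move=> br bl fE gE.
apply: (@is_derive_frozen _ _ _ _ (fun s => b (f s)) (fun v => b df v)) => // v.
have := @is_derive_frozen _ _ _ _ (fun _ => b^~ v) (fun=> 0) f df t (fun=> bl v)
  (fun u => is_derive_cst _ _ _) fE.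
by rewrite add0r.
Qed.

Lemma is_derive_mulmx (R : realType) (m n p : nat) (f : R -> 'M[R]_(m, n))
    (g : R -> 'M[R]_(n, p)) (t : R) df dg :
  is_derive t 1 f df -> is_derive t 1 g dg ->
  is_derive t 1 (fun s => f s *m g s) (df *m g t + f t *m dg).
Proof.
move=> /is_derive_mxP fE /is_derive_mxP gE; apply/is_derive_mxP => i j.
have -> : (fun s => (f s *m g s) i j) =
    \sum_(k < n) ((fun s => f s i k) * (fun s => g s k j)).
  by apply/funext => s; rewrite mxE fct_sumE.
rewrite !mxE -big_split /=; apply: is_derive_sum => k.
have := is_deriveM (fE i k) (gE k j); rewrite /GRing.scale /= => H.
by rewrite addrC [df i k * _]mulrC.
Qed.

Lemma mulmx_norm_le (R : realType) (m n p : nat) (A : 'M[R]_(m, n)) (B : 'M[R]_(n, p)) :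
  `|A *m B| <= n%:R * `|A| * `|B|.
Proof.
apply: mx_norm_le => [|i j]; first by rewrite !mulr_ge0.
rewrite mxE (le_trans (ler_norm_sum _ _ _))//.
have -> : n%:R * `|A| * `|B| = \sum_(k < n) `|A| * `|B|.
  by rewrite sumr_const card_ord -mulrA mulr_natl.
by apply: ler_sum => k _; rewrite normrM ler_pM// mx_norm_coord.
Qed.

Lemma mx_continuous_coord (R : realType) (T : topologicalType) (m n : nat)
    (f : T -> 'M[R]_(m, n)) t :
  (forall i j, {for t, continuous (fun s => f s i j)}) -> {for t, continuous f}.
Proof.
move=> cf; apply/cvgrPdist_le => e e0; near=> s.
apply: mx_norm_le; first exact: ltW.
move=> i j; rewrite !mxE; move: i j; near: s.
apply: filter_forall => i; apply: filter_forall => j.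
exact: (cvgrPdist_le _ _).1 (cf i j) e e0.
Unshelve. all: by end_near. Qed.

Lemma rV_linear_differentiable (R : realType) (n : nat) (W : normedModType R)
    (f : 'rV[R]_n -> W) t : linear f -> differentiable f t.
Proof.
move=> lf; have -> : f = \sum_(l < n) (fun u : 'rV[R]_n => u 0 l *: f (delta_mx 0 l)).
  by apply/funext => u; rewrite (linear_sum_coord _ lf) fct_sumE.
apply: differentiable_sum => l; apply: differentiableZl; exact: differentiable_coord.
Qed.

Lemma rV_linear_continuous (R : realType) (n : nat) (W : normedModType R)
    (f : 'rV[R]_n -> W) : linear f -> continuous f.
Proof. by move=> lf t; exact/differentiable_continuous/rV_linear_differentiable. Qed.

(** For each component l, the Gram matrix v of [De] on the standard basis satisfies v' = - v A - B v
    with v 0 = 0, a linear equation to which [gronwall_unique] applies. *)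
Lemma bilinear_ode_unique (R : realType) (n p : nat)
    (De : R -> 'rV[R]_n -> 'rV[R]_n -> 'rV[R]_p) (P Q : R -> 'rV[R]_n -> 'rV[R]_n) :
  (forall t u, linear (De t u)) -> (forall t v, linear (De t ^~ v)) ->
  (forall t, linear (P t)) -> (forall t, linear (Q t)) ->
  (forall u, continuous (P^~ u)) -> (forall u, continuous (Q^~ u)) ->
  (forall u v, De 0 u v = 0) ->
  (forall u v (t : R), is_derive t 1 (fun s => De s u v) (- De t u (P t v) - De t (Q t u) v)) ->
  forall t u v, De t u v = 0.
Proof.
move=> Dr Dl lP lQ cP cQ De0 DeE.
have main l t i j : De t (delta_mx 0 i) (delta_mx 0 j) 0 l = 0.
  pose v s : 'M[R]_n := \matrix_(i, j) De s (delta_mx 0 i) (delta_mx 0 j) 0 l.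
  pose A s := (lin1_mx (P s))^T; pose B s := lin1_mx (Q s).
  have cA : continuous (fun s => `|A s|).
    move=> s; apply: continuous_comp; last exact: norm_continuous.
    apply: mx_continuous_coord => a b.
    have -> : (fun s => A s a b) = (fun s => P s (delta_mx 0 b) 0 a).
      by apply/funext => s'; rewrite !mxE.
    apply: (@continuous_comp _ _ _ (P^~ _) (fun M : 'rV[R]_n => M 0 a)); first exact: cP.
    exact: coord_continuous.
  have cB : continuous (fun s => `|B s|).
    move=> s; apply: continuous_comp; last exact: norm_continuous.
    apply: mx_continuous_coord => a b.
    have -> : (fun s => B s a b) = (fun s => Q s (delta_mx 0 a) 0 b).
      by apply/funext => s'; rewrite !mxE.
    apply: (@continuous_comp _ _ _ (Q^~ _) (fun M : 'rV[R]_n => M 0 b)); first exact: cQ.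
    exact: coord_continuous.
  pose lam s := n%:R * (`|A s| + `|B s|).
  have clam : continuous lam.
    by move=> s; apply: cvgM; [exact: cvg_cst|apply: cvgD; [exact: cA|exact: cB]].
  have [Lam [Lam0 LamE]] := continuous_antiderivative clam.
  have vE (s : R) : is_derive s 1 v (- (v s *m A s) - B s *m v s).
    apply/is_derive_mxP => a b.
    have -> : (fun s => v s a b) = (fun s => De s (delta_mx 0 a) (delta_mx 0 b) 0 l).
      by apply/funext => s'; rewrite !mxE.
    have /is_derive_mxP/(_ 0 l) := DeE (delta_mx 0 a) (delta_mx 0 b) s.
    rewrite !mxE (linear_sum_coord _ (Dr s _)) (linear_sum_coord _ (Dl s _)).
    rewrite !summxE.
    rewrite (eq_bigr (fun j => v s a j * A s j b)); last first.
      by move=> k _; rewrite !mxE mulrC.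
    rewrite [X in _ - X](eq_bigr (fun j => B s a j * v s j b)) //.
    by move=> k _; rewrite !mxE.
  have v0 : v 0 = 0 by apply/matrixP => a b; rewrite !mxE De0 mxE.
  have lam0 s : 0 <= lam s by rewrite mulr_ge0// addr_ge0.
  have := gronwall_unique lam0 Lam0 LamE (normr_ge0 t) v0 (fun s _ => vE s) _ (lexx `|t|).
  move=> /(_ _)/matrixP/(_ i j); rewrite !mxE; apply.
  move=> s _; rewrite (le_trans (ler_normB _ _))// normrN /lam mulrDr mulrDl lerD//.
    by rewrite (le_trans (mulmx_norm_le _ _))// mulrAC.
  exact: mulmx_norm_le.
move=> t u v; rewrite (linear_sum_coord _ (Dl t v)) big1// => i _.
rewrite (linear_sum_coord _ (Dr t _)) big1 ?scaler0// => j _.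
have -> : De t (delta_mx 0 i) (delta_mx 0 j) = 0 by apply/rowP => l; rewrite main mxE.
by rewrite scaler0.
Qed.

Lemma mulmx_continuous (R : realType) (T : topologicalType) (m n p : nat)
    (f : T -> 'M[R]_(m, n)) (g : T -> 'M[R]_(n, p)) t :
  {for t, continuous f} -> {for t, continuous g} ->
  {for t, continuous (fun s => f s *m g s)}.
Proof.
move=> cf cg; apply: mx_continuous_coord => i j.
have -> : (fun s => (f s *m g s) i j) = (fun s => \sum_k f s i k * g s k j).
  by apply/funext => s; rewrite mxE.
apply: cvg_big => [|k _]; first exact: add_continuous.
apply: cvgM.
- apply: (@continuous_comp _ _ _ f (fun M : 'M[R]_(m, n) => M i k)) => //.
  exact: coord_continuous.
- apply: (@continuous_comp _ _ _ g (fun M : 'M[R]_(n, p) => M k j)) => //.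
  exact: coord_continuous.
Qed.

(* The developing map sends the geodesic to the straight line t v: in the affine
   representation u |-> (L_u, u) the right-invariant velocity of a geodesic is
   y = (1 + t R_v)^-1 v, and B is the inverse of its linear holonomy, so that the
   left-invariant velocity is B v, while C = B (1 + t R_v) is the inverse of the
   adjoint holonomy. *)
Lemma left_symmetric_flow_complete (R : realType) (n : nat)
    (p : 'rV[R]_n -> 'rV[R]_n -> 'rV[R]_n) (v : 'rV[R]_n) (m : nat) :
  (forall v, linear (p^~ v)) -> (forall u, linear (p u)) ->
  (forall x y z, p x (p y z) - p y (p x z) = p (p x y - p y x) z) ->
  (lin1_mx (p^~ v) : 'M[R]_n) ^+ m = 0 ->
  exists x, x 0 = v /\ forall t : R, is_derive t 1 x (- p (x t) (x t)).
Proof.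
move=> pl pr lsa Rv0.
have addl u u' w : p (u + u') w = p u w + p u' w.
  by have := pl w 1 u u'; rewrite !scale1r.
have addr u w w' : p u (w + w') = p u w + p u w'.
  by have := pr u 1 w w'; rewrite !scale1r.
have zerol w : p 0 w = 0 by apply: (addrI (p 0 w)); rewrite -addl !addr0.
have zeror w : p w 0 = 0 by apply: (addrI (p w 0)); rewrite -addr !addr0.
have scl a u w : p (a *: u) w = a *: p u w.
  by have := pl w a u 0; rewrite addr0 zerol addr0.
have scr a u w : p u (a *: w) = a *: p u w.
  by have := pr u a w 0; rewrite addr0 zeror addr0.
have oppl u w : p (- u) w = - p u w by rewrite -scaleN1r scl scaleN1r.
have oppr u w : p u (- w) = - p u w by rewrite -scaleN1r scr scaleN1r.
pose Rv : 'M[R]_n := lin1_mx (p^~ v).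
have RvE u : u *m Rv = p u v by exact: mul_rV_lin1_linear.
(* Finite Neumann series: since the m-th power of [Rv] vanishes, this is (1 + t R_v)^-1 v for every
   t. *)
pose y (t : R) := \sum_(k < m) (- t) ^+ k *: (v *m Rv ^+ k).
have yE t : y t + t *: p (y t) v = v.
  have -> : t *: p (y t) v = \sum_(k < m) - ((- t) ^+ k.+1 *: (v *m Rv ^+ k.+1)).
    rewrite -RvE mulmx_suml scaler_sumr; apply: eq_bigr => k _.
    rewrite -scalemxAl scalerA [Rv ^+ k.+1]exprSr [v *m (_ * _)]mulmxA exprS.
    by rewrite mulNr -scaleNr opprK.
  rewrite -big_split /=.
  have := telescope_sumr (fun k => - ((- t) ^+ k *: (v *m Rv ^+ k))) (leq0n m).
  rewrite big_mkord (eq_bigr (fun k : 'I_m => (- t) ^+ k *: (v *m Rv ^+ k) +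
    - ((- t) ^+ k.+1 *: (v *m Rv ^+ k.+1)))); last first.
    by move=> k _; rewrite opprK addrC.
  by move=> ->; rewrite Rv0 mulmx0 scaler0 oppr0 sub0r opprK expr0 scale1r expr0 mulmx1.
have cy : continuous y.
  move=> t; apply: cvg_big => [|k _]; first exact: add_continuous.
  apply: cvgZ; last exact: cvg_cst.
  apply: (@continuous_comp _ _ _ (fun s : R => - s) (fun s => s ^+ k)).
    by apply: cvgN; exact: cvg_id.
  exact: exprn_continuous.
pose Lm u : 'M[R]_n := lin1_mx (p u).
have LmE u w : w *m Lm u = p u w by exact: mul_rV_lin1_linear.
have lLm : linear Lm.
  move=> a u w; apply/row_matrixP => i; rewrite !rowE mulmxDr -scalemxAr !LmE.
  by rewrite addl scl.
have cL : continuous (fun t => Lm (y t)).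
  move=> t; apply: (@continuous_comp _ _ _ y Lm); first exact: cy.
  exact: rV_linear_continuous.
have [Bm [Bm0 BmE]] : exists Bm : R -> 'M[R]_n,
    Bm 0 = 1%:M /\ forall t : R, is_derive t 1 Bm (- (Lm (y t) *m Bm t)).
  apply: (@picard_lindelof _ _ _ (fun t X => - (Lm (y t) *m X))
    (fun t => n%:R * `|Lm (y t)|)).
  - move=> t; apply: cvgM; first exact: cvg_cst.
    by apply: continuous_comp; [exact: cL|exact: norm_continuous].
  - by move=> t; rewrite mulr_ge0.
  - by move=> t X Y; rewrite -opprD normrN -mulmxBr mulmx_norm_le.
  - by move=> X cX t; apply: cvgN; exact: (mulmx_continuous (cL t) (cX t)).
pose B t (u : 'rV[R]_n) : 'rV[R]_n := u *m Bm t.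
have lB t : linear (B t) by move=> a u w; rewrite /B mulmxDl -scalemxAl.
have BE u (t : R) : is_derive t 1 (B^~ u) (- B t (p (y t) u)).
  have := is_derive_mulmx (is_derive_cst u t 1) (BmE t).
  by rewrite mul0mx add0r mulmxN mulmxA LmE.
have BD t u w : B t (u + w) = B t u + B t w by rewrite /B mulmxDl.
have BN t u : B t (- u) = - B t u by rewrite /B mulNmx.
pose C t u := B t (u + t *: p u v).
have lC t : linear (C t).
  move=> a u w; rewrite /C -lB; congr (B t _).
  by rewrite addl scl !scalerDr !scalerA [t * a]mulrC addrACA.
have CE u (t : R) : is_derive t 1 (C^~ u) (- C t (p (y t) u - p u (y t))).
  have wE := is_derive_line u (p u v) t.
  have := is_derive_frozen lB (fun u => BE u t) wE.
  suff -> : - B t (p (y t) (u + t *: p u v)) + B t (p u v) =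
    - C t (p (y t) u - p u (y t)) by [].
  rewrite /C -!BN -BD; congr (B t _).
  have h := lsa (y t) u v.
  have {2}-> : p u v = p u (y t) + t *: p u (p (y t) v) by rewrite -scr -addr yE.
  rewrite -h addr scr.
  move: (p (y t) u) (p (y t) (p u v)) (p u (y t)) (p u (p (y t) v)) => a b c d.
  by apply/rowP => j; rewrite !mxE; ring.
have Cy t : C t (y t) = B t v by rewrite /C yE.
(* The defect of the intertwining relation B (u.w) = (C u).(B w). Left symmetry gives it a
   homogeneous linear equation. Once it vanishes, u = y t and w = v together with C y = B v turn (B
   v)' = - B (y.v) into the quadratic equation for B v. *)
pose De t u w := B t (p u w) - p (C t u) (B t w).
have De0 : forall t u w, De t u w = 0.
  apply: (@bilinear_ode_unique _ _ _ _ (fun t => p (y t))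
    (fun t u => p (y t) u - p u (y t))).
  - move=> t u a w w'; rewrite /De pr !lB pr scalerBr opprD addrACA.
    by [].
  - move=> t w a u u'; rewrite /De pl !lB lC pl scalerBr opprD addrACA.
    by [].
  - by [].
  - by move=> t a u w; rewrite pr pl scalerBr opprD addrACA.
  - move=> u t; apply: (@continuous_comp _ _ _ y (p^~ u)); first exact: cy.
    exact: rV_linear_continuous.
  - move=> u t; apply: cvgB.
      apply: (@continuous_comp _ _ _ y (p^~ u)); first exact: cy.
      exact: rV_linear_continuous.
    apply: (@continuous_comp _ _ _ y (p u)); first exact: cy.
    exact: rV_linear_continuous.
  - by move=> u w; rewrite /De /C /B Bm0 !mulmx1 scale0r addr0 subrr.
  - move=> u w t.
    have h1 := BE (p u w) t.
    have h2 := is_derive_bilinear pr pl (CE u t) (BE w t).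
    have := is_deriveB h1 h2; rewrite /De.
    set d1 := (X in is_derive _ _ _ X -> _); set d2 := (X in _ -> is_derive _ _ _ X).
    suff -> : d1 = d2 by [].
    rewrite /d1 /d2 oppl oppr -(lsa (y t) u w) opprB !BD !BN.
    move: (B t (p (y t) (p u w))) (B t (p u (p (y t) w))) => a b.
    move: (p (C t _) (B t w)) (p (C t u) _) => c d.
    by apply/rowP => j; rewrite !mxE; ring.
exists (fun t => B t v); split; first by rewrite /B Bm0 mulmx1.
move=> t; have := BE v t.
suff -> : B t (p (y t) v) = p (B t v) (B t v) by [].
by apply/eqP; rewrite -subr_eq0 -{1}Cy -/(De t (y t) v) De0.
Qed.

(** * Differential calculus *)

Lemma near_eq_differentiable (R : realType) (V W : normedModType R) (f g : V -> W) (x : V) :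
  {near x, f =1 g} -> differentiable f x -> differentiable g x.
Proof.
move=> fg df.
have gx := nbhs_singleton fg.
have /eqaddoP fo := diff_locally df.
have e : g \o shift x = cst (g x) + 'd f x +o_ (0 : V) id.
  apply/eqaddoP => eps eps0; have := fo _ eps0.
  move: fg; rewrite (near_shift 0) subr0 => fg.
  by apply: filterS2 fg => h /= fgh; rewrite !fctE /= fgh gx.
have cd := diff_continuous df.
have dgE := diff_unique cd e.
by apply/diff_locallyP; rewrite dgE.
Qed.

Lemma derive_linear (R : realType) (V W : normedModType R) (f : V -> W) (x : V) :
  differentiable f x -> linear (fun v => 'D_v f x).
Proof. by move=> df a u v; rewrite !deriveE// linearP. Qed.

Lemma derive_comp (R : realType) (U V W : normedModType R) (f : U -> V) (g : V -> W)
    (x v : U) : differentiable f x -> differentiable g (f x) ->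
  'D_v (g \o f) x = 'D_('D_v f x) g (f x).
Proof.
move=> df dg; rewrite deriveE; last exact: differentiable_comp.
by rewrite diff_comp//= !deriveE.
Qed.

Lemma is_derive_comp_curve (R : realType) (V W : normedModType R) (c : R -> V)
    (g : V -> W) (t : R) dc :
  is_derive t 1 c dc -> differentiable g (c t) ->
  is_derive t 1 (g \o c) ('D_dc g (c t)).
Proof.
case=> /derivable1_diffP dcd <- dg.
split; first by apply/derivable1_diffP; exact: differentiable_comp.
by rewrite derive_comp.
Qed.

Lemma near_open (T : topologicalType) (U : set T) (P : T -> Prop) x : open U -> U x ->
  (forall y, U y -> P y) -> \near x, P x.
Proof. by move=> Uo Ux UP; apply: filterS UP _; exact: open_nbhs_nbhs. Qed.

Lemma near_comp (T U : topologicalType) (c : T -> U) (P : U -> Prop) t :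
  {for t, continuous c} -> (\forall z \near c t, P z) -> \forall s \near t, P (c s).
Proof. by move=> cc H; exact: cc _ H. Qed.

Lemma Ck_eq (R : realType) (V W : normedModType R) (k : nat) (U : set V) (f g : V -> W) :
  open U -> (forall x, U x -> f x = g x) -> Ck k U f -> Ck k U g.
Proof.
move=> Uo; elim: k f g => [|k IH] f g fg /=.
  move=> cf x Ux; have : f y @[y --> x] --> g x by rewrite -fg//; exact: cf.
  by apply: cvg_trans; apply: near_eq_cvg; exact: (near_open Uo Ux).
move=> [df Df]; split.
  move=> x Ux; apply: near_eq_differentiable (df x Ux).
  exact: (near_open Uo Ux).
move=> v; apply: IH (Df v) => x Ux; apply: near_eq_derive.
exact: (near_open Uo Ux).
Qed.

(** Group multiplication is smooth jointly in two coordinates; this restricts its derivatives to the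
    slice where the second factor is the identity. *)
Lemma Ck_slice (R : realType) (U V W : normedModType R) (k : nat) (A : set U)
    (B : set (U * V)) (f : U * V -> W) (y : V) :
  open A -> (forall x, A x -> B (x, y)) -> Ck k B f -> Ck k A (fun x => f (x, y)).
Proof.
move=> Ao AB; elim: k f => [|k IH] f /=.
  move=> cf x Ax; apply: (@continuous_comp _ _ _ (fun x => (x, y)) f); last exact/cf/AB.
  by apply: cvg_pair; [exact: cvg_id|exact: cvg_cst].
move=> [df Df].
have ds x : is_diff x (fun x : U => (x, y)) (fun v => (v, 0)).
  exact: (is_diff_pair (is_diff_id x) (is_diff_cst y x)).
split=> [x Ax|v].
  by apply: (@differentiable_comp _ _ _ _ (fun x => (x, y)) f) => //; exact/df/AB.
apply: Ck_eq (IH _ (Df (v, 0))) => // x Ax.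
rewrite (@derive_comp _ _ _ _ (fun x => (x, y)) f)//; last exact/df/AB.
by congr ('D_ _ f _); rewrite deriveE// diff_val.
Qed.

(** * Left-invariant frames *)

Section left_frame.
Context {R : realType} {n : nat} {G : lieGroupType R n}.
Local Notation V := 'rV[R]_n.
Implicit Types (g : G) (i j : @chart_idx R n G) (x z u v : V).
Local Notation phi i := (cphi (@atlas R n G i)).
Local Notation psi i := (cpsi (@atlas R n G i)).
Local Notation dom i := (cdom (@atlas R n G i)).
Local Notation cod i := (ccod (@atlas R n G i)).
Local Notation z0 := (phi_at (1%g : G) 1%g).
Local Notation psi0 := (psi_at (1%g : G)).

Lemma cod_phi_at g : cod (chart_at g) (phi_at g g).
Proof. exact/cphi_cod/chart_at_dom. Qed.

Lemma psi_phi_at g : psi (chart_at g) (phi_at g g) = g.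
Proof. exact/cphiK/chart_at_dom. Qed.

Lemma mulg_continuous : continuous (fun pq : G * G => (pq.1 * pq.2)%g).
Proof. by case: (@smooth_mulg R n G). Qed.

Lemma mulg_psi_continuous g j z :
  cod j z -> {for z, continuous (fun y => g * psi j y)%g}.
Proof.
move=> jz.
apply: (@continuous_comp _ _ _ (fun y => (g, psi j y)) (fun pq : G * G => (pq.1 * pq.2)%g)).
  have h1 : (fun=> g) @ z --> g := @cst_continuous V G g z.
  exact: (cvg_pair h1 (cpsi_continuous jz)).
exact: mulg_continuous.
Qed.

Lemma near_mulg_psi g j i z : cod j z -> dom i (g * psi j z)%g ->
  \forall y \near z, cod j y /\ dom i (g * psi j y)%g.
Proof.
move=> jz iz; near=> y; split.
  by near: y; apply: near_open jz _ => //; exact: ccod_open.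
near: y; apply: (mulg_psi_continuous jz).
by apply: open_nbhs_nbhs; split => //; exact: cdom_open.
Unshelve. all: by end_near. Qed.

Lemma translation_differentiable g j i z : cod j z -> dom i (g * psi j z)%g ->
  differentiable (fun y => phi i (g * psi j y)%g) z.
Proof.
move=> jz iz; have [_ /(_ (chart_at g) j i 1%N)[+ _]] := @smooth_mulg R n G.
move=> /(_ (phi_at g g, z)) /= /[!psi_phi_at] df.
have ds : is_diff z (fun y => (phi_at g g, y)) (fun v => (0, v)).
  exact: (is_diff_pair (is_diff_cst (phi_at g g) z) (is_diff_id z)).
have := @differentiable_comp _ _ _ _ (fun y => (phi_at g g, y)) _ z _ (df _).
rewrite /comp /= psi_phi_at; apply => //.
by split => //; exact: cod_phi_at.
Qed.

(** The components of u^+ in a fixed chart i. The field [left_invariant_vf] is read in the preferred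
    chart of each point, which may jump, so derivatives are taken on this version. *)
Definition left_frame i x u : V :=
  'd (fun z => phi i (psi i x * psi0 z)%g) z0 u.

Lemma psi0_z0 : psi0 z0 = 1%g :> G.
Proof. exact: psi_phi_at. Qed.

Lemma left_frame_linear i x : linear (left_frame i x).
Proof. by move=> a u v; rewrite /left_frame linearP. Qed.

Lemma left_frame_differentiable i x : cod i x ->
  differentiable (fun z => phi i (psi i x * psi0 z)%g) z0.
Proof.
move=> ix; apply: translation_differentiable; first exact: cod_phi_at.
by rewrite psi_phi_at mulg1; exact: cpsi_dom.
Qed.

Lemma left_frameE i x u : cod i x ->
  left_frame i x u = 'D_u (fun z => phi i (psi i x * psi0 z)%g) z0.
Proof. by move=> ix; rewrite deriveE//; exact: left_frame_differentiable. Qed.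

(** Left invariance of the frame: associativity of the product and the chain rule. With g = 1 it
    becomes the change of charts. *)
Lemma left_frame_translation g j i z u : cod j z -> dom i (g * psi j z)%g ->
  'D_(left_frame j z u) (fun y => phi i (g * psi j y)%g) z =
  left_frame i (phi i (g * psi j z)%g) u.
Proof.
move=> jz iz; rewrite !left_frameE//; last exact: cphi_cod.
have fz0 : phi j (psi j z * psi0 z0)%g = z by rewrite psi0_z0 mulg1 cpsiK.
rewrite -[X in 'D__ _ X]fz0.
rewrite -(@derive_comp _ _ _ _ (fun w => phi j (psi j z * psi0 w)%g)
  (fun y => phi i (g * psi j y)%g)) ?fz0; last 2 first.
- exact: left_frame_differentiable.
- exact: translation_differentiable.
apply: near_eq_derive.
have : dom j (psi j z * psi (chart_at 1%g) z0)%g.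
  by rewrite psi_phi_at mulg1; exact: cpsi_dom.
move=> /(near_mulg_psi (cod_phi_at 1%g)); apply: filterS => w [_ jw] /=.
by rewrite cphiK// cphiK// mulgA.
Qed.

End left_frame.

Section left_invariant_calculus.
Context {R : realType} {n : nat} {G : lieGroupType R n}.
Local Notation V := 'rV[R]_n.
Implicit Types (g : G) (i j : @chart_idx R n G) (x z u v : V).
Local Notation phi i := (cphi (@atlas R n G i)).
Local Notation psi i := (cpsi (@atlas R n G i)).
Local Notation dom i := (cdom (@atlas R n G i)).
Local Notation cod i := (ccod (@atlas R n G i)).
Local Notation z0 := (phi_at (1%g : G) 1%g).
Local Notation psi0 := (psi_at (1%g : G)).
Local Notation k0 := (@chart_at R n G 1%g).

(** The frame is the derivative of multiplication in the direction (0, u) along the slice of second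
    coordinate [z0]; one order of differentiability is spent on it, hence [k.+1]. *)
Lemma left_frame_smooth i u : smooth_on (cod i) (left_frame i ^~ u).
Proof.
move=> k; have [_ /(_ i k0 i k.+1)[df /(_ (0, u)) Df]] := @smooth_mulg R n G.
have iz x : cod i x -> [/\ cod i x, cod k0 z0 & dom i (psi i x * psi0 z0)%g].
  by move=> ix; rewrite psi0_z0 mulg1; split; [|exact: cod_phi_at|exact: cpsi_dom].
pose F (q : V * V) : V := phi i (psi i q.1 * psi0 q.2)%g.
have := Ck_slice (@ccod_open _ _ _ (atlas i)) iz Df.
apply: Ck_eq; first exact: ccod_open.
move=> x ix; rewrite (left_frameE u ix).
have ds : is_diff z0 (fun y => (x, y)) (fun v => (0, v)).
  exact: (is_diff_pair (is_diff_cst x z0) (is_diff_id z0)).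
have dfx : differentiable F (x, z0) := df (x, z0) (iz x ix).
have := derive_comp u (@ex_diff _ _ _ _ _ _ _ ds) dfx.
have -> : 'D_u (fun y : V => (x, y)) z0 = (0, u).
  by rewrite deriveE ?diff_val.
by move=> ->.
Qed.

Lemma left_frame_diff_base i x u : cod i x -> differentiable (left_frame i ^~ u) x.
Proof. by move=> ix; have [df _] := left_frame_smooth i u 1%N; exact: df. Qed.

Lemma left_invariant_vfE g u :
  left_invariant_vf u g = left_frame (chart_at g) (phi_at g g) u.
Proof. by rewrite /left_invariant_vf /tangent_map /left_frame psi_phi_at mulg1. Qed.

Lemma transition_differentiable i j x : cod i x -> dom j (psi i x) ->
  differentiable (fun y => phi j (psi i y)) x.
Proof. by move=> ix jx; have [df _] := @atlas_compat R n G i j 1%N; exact: df. Qed.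

Lemma left_frame_transition i j x u : cod i x -> dom j (psi i x) ->
  'D_(left_frame i x u) (fun y => phi j (psi i y)) x =
  left_frame j (phi j (psi i x)) u.
Proof.
move=> ix jx; have := @left_frame_translation R n G 1%g i j x u ix.
by under eq_fun do rewrite mul1g; rewrite mul1g; exact.
Qed.

Lemma vf_coord_left_invariant i x u : cod i x ->
  vf_coord (left_invariant_vf u) i x = left_frame i x u.
Proof.
move=> ix; rewrite /vf_coord /tcoord left_invariant_vfE.
set g := psi i x.
have ig : dom i g by exact: cpsi_dom.
have dg : differentiable (fun y => phi i (psi_at g y)) (phi_at g g).
  by apply: transition_differentiable; [exact: cod_phi_at|rewrite psi_phi_at].
rewrite -deriveE//.
have := @left_frame_transition (chart_at g) i (phi_at g g) u (cod_phi_at g).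
by rewrite psi_phi_at /g cpsiK//; apply.
Qed.

Lemma left_invariant_vf_smooth u : smooth_vf (left_invariant_vf (u : lie_algebra G)).
Proof.
move=> i k; apply: Ck_eq (left_frame_smooth i u k); first exact: ccod_open.
by move=> x ix; rewrite vf_coord_left_invariant.
Qed.

Lemma derive_vf_coord_left_invariant i x u w : cod i x ->
  'D_w (vf_coord (left_invariant_vf (u : lie_algebra G)) i) x = 'D_w (left_frame i ^~ u) x.
Proof.
move=> ix; apply: near_eq_derive; apply: (near_open _ ix); first exact: ccod_open.
by move=> y iy; exact: vf_coord_left_invariant.
Qed.

Lemma left_frame1 u : left_frame k0 z0 u = u.
Proof.
rewrite left_frameE; last exact: cod_phi_at.
rewrite -[RHS](derive_id z0 u); apply: near_eq_derive.
apply: (near_open (@ccod_open _ _ _ (atlas k0))); first exact: cod_phi_at.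
by move=> y ky; rewrite psi_phi_at mul1g cpsiK.
Qed.

(** Not intrinsic on its own, but its antisymmetrization is the bracket ([lie_algebra_bracketE]),
    and adding the Christoffel symbol gives the product ([bullet_frame_der]). *)
Definition frame_der u v : V := 'D_u (left_frame k0 ^~ v) z0.


Lemma frame_der_linearl v : linear (frame_der ^~ v).
Proof. by apply: derive_linear; apply: left_frame_diff_base; exact: cod_phi_at. Qed.

Lemma lie_algebra_bracketE u v :
  lie_algebra_bracket (u : lie_algebra G) v = frame_der u v - frame_der v u.
Proof.
rewrite /lie_algebra_bracket /lie_bracket !left_invariant_vfE !left_frame1.
by rewrite !derive_vf_coord_left_invariant//; exact: cod_phi_at.
Qed.

Lemma frame_der_linearr u : linear (frame_der u).
Proof.
move=> a v w; rewrite /frame_der.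
have -> : left_frame k0 ^~ (a *: v + w) =
    a *: (left_frame k0 ^~ v : V -> V) + (left_frame k0 ^~ w : V -> V).
  by apply/funext => y; rewrite left_frame_linear.
have d v' : derivable (left_frame k0 ^~ v' : V -> V) z0 u.
  by apply: diff_derivable; apply: left_frame_diff_base; exact: cod_phi_at.
by rewrite deriveD ?deriveZ//; exact: derivableZ.
Qed.

End left_invariant_calculus.

Arguments frame_der {R n} G u v.

(** * The Lie algebra of a flat symplectic Lie group *)

Lemma scaler_add_shuffle (R : pzRingType) (V : lmodType R) (a : R) (x y x' y' : V) :
  a *: x + y + (a *: x' + y') = a *: (x + x') + (y + y').
Proof. by rewrite scalerDr addrACA. Qed.

Section flat_symplectic_structure.
Context {R : realType} {n : nat} {G : lieGroupType R n}.
Local Notation V := 'rV[R]_n.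
Implicit Types (g : G) (i j : @chart_idx R n G) (x z u v : V).
Local Notation z0 := (phi_at (1%g : G) 1%g).
Local Notation k0 := (@chart_at R n G 1%g).
Context (Omega : G -> V -> V -> R).
Hypothesis Omega_symplectic : symplectic_form Omega.
Hypothesis Omega_left_invariant : left_invariant_form Omega.
Context (bullet : lie_algebra G -> lie_algebra G -> lie_algebra G).
Hypothesis bulletE : is_natural_product (Omega 1%g) bullet.
Context (nabla : connection G).
Hypothesis nablaE : forall (u v : lie_algebra G) (g : G),
  covariant nabla (left_invariant_vf u) (left_invariant_vf v) g =
  left_invariant_vf (bullet u v) g.
Hypothesis nabla_flat : flat nabla.

Lemma christoffel_left_frame g (u v : lie_algebra G) :
  let k := chart_at g in let x := phi_at g g in
  'D_(left_frame k x u) (left_frame k ^~ v) x +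
  christoffel nabla k x (left_frame k x u) (left_frame k x v) =
  left_frame k x (bullet u v).
Proof.
move=> k x; have := nablaE u v g; rewrite /covariant !left_invariant_vfE.
by rewrite derive_vf_coord_left_invariant//; exact: cod_phi_at.
Qed.

(** The frame is the identity at [z0]. Bilinearity of the product is read off from this formula. *)
Lemma bullet_frame_der (u v : V) :
  bullet u v = frame_der G u v + christoffel nabla k0 z0 u v.
Proof. by have := christoffel_left_frame 1%g u v; rewrite /= !left_frame1. Qed.

Lemma bullet_linearl v : linear (bullet^~ v : V -> V).
Proof.
move=> a u w; rewrite !bullet_frame_der frame_der_linearl christoffel_linearl.
exact: scaler_add_shuffle.
Qed.

Lemma bullet_linearr u : linear (bullet u : V -> V).
Proof.
move=> a v w; rewrite !bullet_frame_der frame_der_linearr christoffel_linearr.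
exact: scaler_add_shuffle.
Qed.

Lemma bullet_flat (u v w : lie_algebra G) :
  bullet u (bullet v w) - bullet v (bullet u w) =
  bullet (lie_algebra_bracket u v) w :> V.
Proof.
have sm := @left_invariant_vf_smooth R n G.
have := nabla_flat (sm u) (sm v) (sm w) 1%g; rewrite /curvature.
have cE a b : covariant nabla (left_invariant_vf a) (left_invariant_vf b) =
  left_invariant_vf (bullet a b) by apply/funext => g; exact: nablaE.
rewrite !cE !left_invariant_vfE !left_frame1 => /eqP; rewrite subr_eq0 => /eqP ->.
(* The first argument of [covariant] enters only through its value at the point, so the bracket
   field matters only at the identity. *)
rewrite /covariant left_invariant_vfE left_frame1 bullet_frame_der.
by rewrite derive_vf_coord_left_invariant//; exact: cod_phi_at.
Qed.

Let omega : V -> V -> R := Omega 1%g.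

Let form_linearr g u : scalar (Omega g u).
Proof. by case: Omega_symplectic => -[]. Qed.

Let form_linearl g v : scalar (Omega g ^~ v).
Proof. by case: Omega_symplectic => -[]. Qed.

Let w_anti u v : omega u v = - omega v u.
Proof.
have [_ wA _ _ _] := Omega_symplectic.
have l1 := form_linearl 1%g (u + v) 1 u v; have l2 := form_linearr 1%g u 1 u v.
have l3 := form_linearr 1%g v 1 u v.
rewrite !scale1r !mul1r ?wA in l1 l2 l3.
by move: l1 l2 l3 (wA 1%g u) (wA 1%g v); rewrite /omega; lra.
Qed.

(** Left invariance of Omega: its coefficients in the left frame are constant. *)
Lemma form_coord_left_frame (x u v : V) : ccod (atlas k0) x ->
  form_coord Omega k0 x (left_frame k0 x u) (left_frame k0 x v) = omega u v.
Proof.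
move=> kx; rewrite /form_coord; set g := cpsi (atlas k0) x.
have tE w : tvect k0 x (left_frame k0 x w) = left_invariant_vf (w : lie_algebra G) g.
  have gd : cdom (atlas (chart_at g)) (cpsi (atlas k0) x) by exact: chart_at_dom.
  rewrite left_invariant_vfE /tvect -/g -deriveE; last exact: transition_differentiable.
  exact: left_frame_transition.
by rewrite !tE /left_invariant_vf; have := Omega_left_invariant g 1%g u v; rewrite mulg1.
Qed.

(** The derivative at [z0] of the constant Omega(u^+, v^+) along the line of direction a. *)
Lemma form_coord_derive (a u v : V) :
  'D_a (fun y => form_coord Omega k0 y u v : R^o) z0 +
  omega (frame_der G a u) v + omega u (frame_der G a v) = 0.
Proof.
pose c (s : R) : V := z0 + s *: a.
have c0 : c 0 = z0 by rewrite /c scale0r addr0.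
have cE : is_derive (0 : R) 1 c a by exact: is_derive_line.
(* The values are put in 1 by 1 matrices so that [is_derive_frozen], used once for each argument,
   applies. *)
pose F (s : R) u' v' : 'M[R]_1 := const_mx (form_coord Omega k0 (c s) u' v').
have Fr s u' : linear (F s u').
  move=> r y y'; apply/matrixP => ? ?; rewrite !mxE /form_coord /tvect linearP.
  by rewrite form_linearr.
have Fl s v' : linear (F s ^~ v').
  move=> r y y'; apply/matrixP => ? ?; rewrite !mxE /form_coord /tvect linearP.
  by rewrite form_linearl.
have k0z0 : ccod (atlas k0) z0 by exact: cod_phi_at.
have FE u' v' : is_derive (0 : R) 1 (fun s => F s u' v')
    (const_mx ('D_a (fun y => form_coord Omega k0 y u' v' : R^o) z0)).
  apply/is_derive_mxP => i j; rewrite !mxE.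
  have [_ _ _ sm _] := Omega_symplectic.
  have [df _] := sm k0 u' v' 1%N.
  have dc : differentiable (fun y => form_coord Omega k0 y u' v' : R^o) (c 0).
    by rewrite c0; exact: df.
  have := is_derive_comp_curve cE dc; rewrite c0 => h.
  by under eq_fun do rewrite mxE.
have lfE w : is_derive (0 : R) 1 (fun s => left_frame k0 (c s) w) (frame_der G a w).
  have dl : differentiable (left_frame k0 ^~ w) (c 0).
    by rewrite c0; exact: left_frame_diff_base.
  have h := is_derive_comp_curve cE dl; rewrite c0 in h; exact: h.
have h1 v' := is_derive_frozen (fun s => Fl s v') (fun u' => FE u' v') (lfE u).
have Gl s : linear (fun v' => F s (left_frame k0 (c s) u) v') by exact: Fr.
have := is_derive_frozen Gl h1 (lfE v).
have : is_derive (0 : R) 1 (fun s => F s (left_frame k0 (c s) u) (left_frame k0 (c s) v))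
    (0 : 'M[R]_1).
  apply: (near_eq_is_derive _ (is_derive_cst (const_mx (omega u v)) (0 : R) 1)).
  have cc : {for 0, continuous c} by exact: is_derive_continuous cE.
  have : nbhs (c 0) (ccod (atlas k0)).
    by rewrite c0; apply: open_nbhs_nbhs; split => //; exact: ccod_open.
  move=> /cc H; near=> s.
  have ks : ccod (atlas k0) (c s) by near: s.
  by apply/matrixP => ? ?; rewrite !mxE form_coord_left_frame.
move=> [_ e1] [_ e2]; move: e2; rewrite e1 => /esym/matrixP/(_ 0 0).
rewrite !mxE c0 !left_frame1.
have F0 (p q : V) : form_coord Omega k0 z0 p q = omega p q.
  by have := form_coord_left_frame p q k0z0; rewrite !left_frame1.
by rewrite !F0.
Unshelve. all: by end_near. Qed.

Let w_sub x y z : omega (x - y) z = omega x z - omega y z.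
Proof.
have := form_linearl 1%g z (-1) y x; rewrite scaleN1r mulN1r => e.
by rewrite (addrC x) [LHS]e addrC.
Qed.

(** Replacing the three derivatives in [closed_form] by means of [form_coord_derive] groups the
    frame derivatives into brackets. *)
Lemma omega_cocycle (u v w : V) :
  omega (lie_algebra_bracket (u : lie_algebra G) v) w +
  omega (lie_algebra_bracket (v : lie_algebra G) w) u +
  omega (lie_algebra_bracket (w : lie_algebra G) u) v = 0.
Proof.
have [_ _ _ _ cl] := Omega_symplectic.
have := cl k0 z0 u v w (cod_phi_at _).
have := form_coord_derive u v w; have := form_coord_derive v w u.
have := form_coord_derive w u v.
rewrite !lie_algebra_bracketE.
move: ('D_u _ z0) ('D_v _ z0) ('D_w _ z0) => d1 d2 d3.
move: (frame_der G u v) (frame_der G v u) (frame_der G v w) (frame_der G w v)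
  (frame_der G w u) (frame_der G u w) => uv vu vw wv wu uw.
rewrite !w_sub; have := w_anti v uw; have := w_anti w vu.
have := w_anti u wv; lra.
Qed.

(** In omega(u.v - v.u, w) the cocycle identity converts the two terms with [u, w] and [v, w] into a
    third copy of omega([u, v], w), which cancels the factor 1/3. *)
Lemma bullet_torsion_free (u v : V) :
  lie_algebra_bracket (u : lie_algebra G) v = bullet u v - bullet v u.
Proof.
have [_ _ nd _ _] := Omega_symplectic.
apply/eqP; rewrite -subr_eq0; apply/eqP/(nd 1%g) => w.
pose br (x y : V) : V := lie_algebra_bracket (x : lie_algebra G) y.
have e1 : omega (bullet u v) w = 3^-1 * (omega (br u v) w + omega (br u w) v) := bulletE u v w.
have e2 : omega (bullet v u) w = 3^-1 * (omega (br v u) w + omega (br v w) u) := bulletE v u w.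
have e3 : omega (br u v) w + omega (br v w) u + omega (br w u) v = 0 := omega_cocycle u v w.
have anti x y z : omega (br x y) z = - omega (br y x) z.
  rewrite /br !lie_algebra_bracketE; move: (frame_der G x y) (frame_der G y x) => xy yx.
  by rewrite !w_sub opprB.
have e4 := anti w u v; have e5 := anti v u w.
change (omega (br u v - (bullet u v - bullet v u)) w = 0).
move: (bullet u v) (bullet v u) (br u v) (br u w) (br v w) (br w u) (br v u)
  e1 e2 e3 e4 e5 => uv vu buv buw bvw bwu bvu.
rewrite !w_sub; lra.
Qed.

Lemma bullet_flow_complete (v : V) : exists x : R -> V,
  x 0 = v /\ forall t : R, is_derive t 1 x (- (bullet (x t) (x t) : V)).
Proof.
have [_ wA nd _ _] := Omega_symplectic.
have lsa (x y z : V) : bullet x (bullet y z) - bullet y (bullet x z) =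
    bullet (bullet x y - bullet y x : V) z :> V.
  by rewrite bullet_flat bullet_torsion_free.
have pE (x y z : V) : omega (bullet x y) z =
    3^-1 * (omega (bullet x y - bullet y x : V) z + omega (bullet x z - bullet z x : V) y).
  by rewrite -!bullet_torsion_free; exact: bulletE.
have [m Rm] := @nilpotent_right_mul R n bullet omega bullet_linearl bullet_linearr
  (form_linearr 1%g) (form_linearl 1%g) (wA 1%g) (nd 1%g) lsa pE v.
exact: left_symmetric_flow_complete bullet_linearl bullet_linearr lsa Rm.
Qed.

End flat_symplectic_structure.

(** * Geodesics *)

Lemma mean_value_bound (R : realType) (m n : nat) (v dv : R -> 'M[R]_(m, n)) (a b M : R) :
  a <= b -> 0 <= M -> (forall t : R, a <= t <= b -> is_derive t 1 v (dv t)) ->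
  (forall t, a <= t <= b -> `|dv t| <= M) -> `|v b - v a| <= M * (b - a).
Proof.
move=> ab M0 vE dvM; apply: mx_norm_le => [|i j]; first by rewrite mulr_ge0// subr_ge0.
have dj (t : R) : a <= t <= b -> is_derive t 1 (fun s => v s i j) (dv t i j).
  by move=> /vE /is_derive_mxP.
have dj' t : t \in `]a, b[ -> is_derive t 1 (fun s => v s i j) (dv t i j).
  by rewrite in_itv /= => /andP[/ltW ? /ltW ?]; apply: dj; apply/andP.
have cj : {within `[a, b], continuous (fun s => v s i j)}.
  apply: continuous_in_subspaceT => t; rewrite inE /= in_itv /= => tab.
  exact: is_derive_continuous (dj t tab).
have [c cab] := MVT_segment ab dj' cj.
rewrite !mxE => ->; rewrite normrM [`|b - a|]ger0_norm ?subr_ge0// ler_wpM2r ?subr_ge0//.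
apply: le_trans (mx_norm_coord _ _ _) _.
by apply: dvM; move: cab; rewrite in_itv.
Qed.

Lemma derive_norm_bound (R : realType) (n m : nat) (h : 'rV[R]_n -> 'rV[R]_m) z v M :
  0 <= M -> differentiable h z ->
  (forall l, `|'D_(delta_mx 0 l) h z| <= M) -> `|'D_v h z| <= n%:R * M * `|v|.
Proof.
move=> M0 dh hM; rewrite (linear_sum_coord v (derive_linear dh)).
rewrite (le_trans (ler_norm_sum _ _ _))//.
have -> : n%:R * M * `|v| = \sum_(k < n) `|v| * M.
  by rewrite sumr_const card_ord -mulrA mulr_natl [M * _]mulrC.
by apply: ler_sum => k _; rewrite normrZ ler_pM// mx_norm_coord.
Qed.

Lemma near_closed_ball (R : realType) (V : normedModType R) (z0 : V) (P : V -> Prop) :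
  (\forall z \near z0, P z) -> exists2 r : R, 0 < r & forall z, `|z - z0| <= r -> P z.
Proof.
move=> /nbhs_ballP[e /= e0 eP]; exists (e / 2); first by rewrite divr_gt0.
move=> z zr; apply: eP; rewrite -ball_normE /= distrC (le_lt_trans zr)//.
by rewrite ltr_pdivrMr// ltr_pMr// ltr1n.
Qed.

(** Mean value inequality along segments of a ball, which is convex. A single constant L serves as
    bound and as Lipschitz constant. *)
Lemma C1_locally_lipschitz (R : realType) (n m : nat) (U : set 'rV[R]_n)
    (h : 'rV[R]_n -> 'rV[R]_m) z0 : open U -> U z0 -> Ck 1 U h ->
  exists2 r : R, 0 < r & exists2 L, 0 <= L & forall z, `|z - z0| <= r ->
    [/\ U z, `|h z| <= L & forall z', `|z' - z0| <= r -> `|h z - h z'| <= L * `|z - z'|].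
Proof.
move=> Uo Uz0 [dh ch].
pose M := 1 + \sum_l `|'D_(delta_mx 0 l) h z0|.
have M0 : 0 <= M by rewrite addr_ge0// sumr_ge0.
have near_D : \forall z \near z0, forall l, `|'D_(delta_mx 0 l) h z| <= M.
  suff nD l : \forall z \near z0, `|'D_(delta_mx 0 l) h z| <= M.
    near=> z => l; move: l; near: z.
    apply: filter_forall => l; exact: nD.
  have cl := ch (delta_mx 0 l) z0 Uz0.
  have lM : `|'D_(delta_mx 0 l) h z0| < M.
    rewrite /M (bigD1 l)//= addrCA ltrDl.
    by rewrite (lt_le_trans ltr01)// lerDl sumr_ge0.
  exact: (cvgr_norm_le _ cl _ lM).
have near_h : \forall z \near z0, `|h z| <= `|h z0| + 1.
  have ch0 := differentiable_continuous (dh z0 Uz0).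
  have lh : `|h z0| < `|h z0| + 1 by rewrite ltrDl.
  exact: (cvgr_norm_le _ ch0 _ lh).
have near_U : \forall z \near z0, U z by exact: open_nbhs_nbhs.
have [r r0 rP] : exists2 r : R, 0 < r & forall z, `|z - z0| <= r ->
    [/\ U z, `|h z| <= `|h z0| + 1 & forall l, `|'D_(delta_mx 0 l) h z| <= M].
  apply: near_closed_ball; near=> z; split; near: z => //.
exists r => //; exists (`|h z0| + 1 + n%:R * M); first by rewrite !addr_ge0// mulr_ge0.
move=> z zr; have [Uz hz _] := rP z zr; split => //.
  by rewrite (le_trans hz)// lerDl mulr_ge0.
move=> z' z'r.
pose c (s : R) := z' + s *: (z - z').
have cE (s : R) : is_derive s 1 c (z - z') by exact: is_derive_line.
have cr s : 0 <= s <= 1 -> `|c s - z0| <= r.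
  move=> /andP[s0 s1].
  have -> : c s - z0 = s *: (z - z0) + (1 - s) *: (z' - z0).
    by apply/rowP => l; rewrite !mxE; ring.
  rewrite (le_trans (ler_normD _ _))// !normrZ.
  have s1' : 0 <= 1 - s by rewrite subr_ge0.
  rewrite (ger0_norm s0) (ger0_norm s1').
  have -> : r = s * r + (1 - s) * r by ring.
  by rewrite lerD// ler_wpM2l.
have hcE (s : R) : 0 <= s <= 1 -> is_derive s 1 (h \o c) ('D_(z - z') h (c s)).
  move=> s01; have [Us _ _] := rP _ (cr s s01).
  exact: (is_derive_comp_curve (cE s) (dh _ Us)).
have hcM (s : R) : 0 <= s <= 1 -> `|'D_(z - z') h (c s)| <= n%:R * M * `|z - z'|.
  move=> s01; have [Us _ Ms] := rP _ (cr s s01).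
  by apply: derive_norm_bound => //; exact: dh.
have := mean_value_bound ler01 _ hcE hcM.
have c1 : c 1 = z by rewrite /c scale1r addrC subrK.
have c00 : c 0 = z' by rewrite /c scale0r addr0.
rewrite /= c1 c00 subr0 mulr1 => H; apply: le_trans (H _) _.
  by rewrite !mulr_ge0.
by rewrite ler_wpM2r// lerDr addr_ge0.
Unshelve. all: by end_near. Qed.

Lemma C1_locally_lipschitz_family (R : realType) (n m : nat) (I : finType)
    (U : set 'rV[R]_n) (h : I -> 'rV[R]_n -> 'rV[R]_m) z0 :
  open U -> U z0 -> (forall a, Ck 1 U (h a)) ->
  exists2 r : R, 0 < r & exists2 L, 0 <= L & forall z, `|z - z0| <= r ->
    U z /\ forall a, `|h a z| <= L /\
      forall z', `|z' - z0| <= r -> `|h a z - h a z'| <= L * `|z - z'|.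
Proof.
move=> Uo Uz0 hC.
have := fun a => C1_locally_lipschitz Uo Uz0 (hC a).
move=> H.
have H' a : exists rL : R * R, [/\ 0 < rL.1, 0 <= rL.2 & forall z, `|z - z0| <= rL.1 ->
    [/\ U z, `|h a z| <= rL.2 & forall z', `|z' - z0| <= rL.1 ->
      `|h a z - h a z'| <= rL.2 * `|z - z'|]].
  by have [r r0 [L L0 rL]] := H a; exists (r, L).
have [rL rLP] := choice H'.
have [r0 r00 r0U] : exists2 r : R, 0 < r & forall z, `|z - z0| <= r -> U z.
  by apply: near_closed_ball; exact: open_nbhs_nbhs.
pose r := \big[Num.min/r0]_a (rL a).1.
pose L := \sum_a (rL a).2.
have LP a : (rL a).2 <= L.
  rewrite /L (bigD1 a)//= lerDl sumr_ge0// => b _.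
  by have [] := rLP b.
have rP a : r <= (rL a).1 by exact: bigmin_le_cond.
exists r.
  by apply: lt_bigmin => // a _; have [] := rLP a.
exists L; first by apply: sumr_ge0 => a _; have [] := rLP a.
move=> z zr; split.
  by apply: r0U; rewrite (le_trans zr)//; exact: bigmin_le_id.
move=> a; have [_ _ aP] := rLP a; have [_ ha hl] := aP z (le_trans zr (rP a)).
split; first exact: le_trans ha (LP a).
move=> z' z'r; apply: le_trans (hl z' (le_trans z'r (rP a))) _.
by rewrite ler_wpM2r.
Qed.

(** * Christoffel symbols in the left-invariant frame *)

Section christoffel.
Context {R : realType} {n : nat} {G : lieGroupType R n}.
Local Notation V := 'rV[R]_n.
Context (bullet : lie_algebra G -> lie_algebra G -> lie_algebra G).
Context (nabla : connection G).
Hypothesis nablaE : forall (u v : lie_algebra G) (g : G),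
  covariant nabla (left_invariant_vf u) (left_invariant_vf v) g =
  left_invariant_vf (bullet u v) g.

(* [nablaE] only speaks of the preferred chart at each point. *)
Lemma christoffel_left_frame_chart (i : @chart_idx R n G) (x u v : V) :
  ccod (atlas i) x ->
  'D_(left_frame i x u) (left_frame i ^~ v) x +
  christoffel nabla i x (left_frame i x u) (left_frame i x v) =
  left_frame i x (bullet u v).
Proof.
move=> ix; set g := cpsi (atlas i) x.
pose k := chart_at g; pose y := phi_at g g.
have ky : ccod (atlas k) y by exact: cod_phi_at.
have kyg : cpsi (atlas k) y = g by exact: psi_phi_at.
have gi : cdom (atlas i) (cpsi (atlas k) y) by rewrite kyg; exact: cpsi_dom.
pose tau (z : V) : V := cphi (atlas i) (cpsi (atlas k) z).
have tauy : tau y = x by rewrite /tau kyg cpsiK.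
pose U := left_frame k y u; pose W := left_frame k y v.
have dtau : differentiable tau y by exact: transition_differentiable.
have tD w : 'D_(left_frame k y w) tau y = left_frame i x w.
  by have := left_frame_transition w ky gi; rewrite -/(tau y) tauy.
pose c (s : R) : V := y + s *: U.
have c0 : c 0 = y by rewrite /c scale0r addr0.
have cE : is_derive (0 : R) 1 c U by exact: is_derive_line.
have nearc : \forall s \near (0 : R),
    ccod (atlas k) (c s) /\ cdom (atlas i) (cpsi (atlas k) (c s)).
  have gi' : cdom (atlas i) (1 * cpsi (atlas k) y)%g by rewrite mul1g.
  have H := near_mulg_psi ky gi'; rewrite -c0 in H.
  have cc : {for 0, continuous c} by exact: is_derive_continuous cE.
  by apply: filterS (near_comp cc H) => s /=; rewrite mul1g.
have tcE : is_derive (0 : R) 1 (tau \o c) (left_frame i x u).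
  have dt : differentiable tau (c 0) by rewrite c0.
  by have := is_derive_comp_curve cE dt; rewrite c0 tD.
have h1 : is_derive (0 : R) 1 ((left_frame i ^~ v) \o (tau \o c))
    ('D_(left_frame i x u) (left_frame i ^~ v) x).
  have e : (tau \o c) 0 = x by rewrite /= c0 tauy.
  have dl : differentiable (left_frame i ^~ v) ((tau \o c) 0).
    by rewrite e; exact: left_frame_diff_base.
  have h := is_derive_comp_curve tcE dl; rewrite e in h; exact: h.
have GE w : is_derive (0 : R) 1 (fun s => 'd tau (c s) w) ('D_U (fun z => 'D_w tau z) y).
  have [_ D2] := @atlas_compat R n G k i 2%N.
  have [d2 _] := D2 w.
  have dd : differentiable (fun z => 'D_w tau z) (c 0) by rewrite c0; exact: d2.
  have h := is_derive_comp_curve cE dd; rewrite c0 in h.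
  apply: near_eq_is_derive h; apply: filterS nearc => s [ks is_] /=.
  by rewrite deriveE//; exact: transition_differentiable.
have wE : is_derive (0 : R) 1 (fun s => left_frame k (c s) v) ('D_U (left_frame k ^~ v) y).
  have dl : differentiable (left_frame k ^~ v) (c 0).
    by rewrite c0; exact: left_frame_diff_base.
  have h := is_derive_comp_curve cE dl; rewrite c0 in h; exact: h.
have lG s : linear (fun w => 'd tau (c s) w) by move=> a p q; rewrite linearP.
have h2 := is_derive_frozen lG GE wE; rewrite c0 -/W in h2.
(* The frame of chart i along the curve is differentiated directly and as the image of the frame of
   chart k under [tau]. The second derivative of [tau] that appears is the one in
   [christoffel_compat], and the two cancel. *)
have e1 : 'D_(left_frame i x u) (left_frame i ^~ v) x =
    'D_U (fun z => 'D_W tau z) y + 'd tau y ('D_U (left_frame k ^~ v) y).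
  have [_ d1] := h1; have [_ d2] := h2.
  apply: (eq_trans (esym d1)); apply: (eq_trans _ d2); apply: near_eq_derive.
  apply: filterS nearc => s [ks is_] /=.
  rewrite -deriveE; last exact: transition_differentiable.
  by rewrite left_frame_transition.
have e2 : 'd tau y (christoffel nabla k y U W) = 'D_U (fun z => 'D_W tau z) y +
    christoffel nabla i (tau y) ('d tau y U) ('d tau y W) := christoffel_compat nabla U W ky gi.
have dU : 'd tau y U = left_frame i x u by rewrite -deriveE//; exact: tD.
have dW : 'd tau y W = left_frame i x v by rewrite -deriveE//; exact: tD.
rewrite tauy dU dW in e2.
have e3 : 'D_('D_U (left_frame k ^~ v) y + christoffel nabla k y U W) tau y =
    left_frame i x (bullet u v).
  have e : 'D_U (left_frame k ^~ v) y + christoffel nabla k y U W =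
    left_frame k y (bullet u v) := christoffel_left_frame nablaE g u v.
  by rewrite e; exact: tD.
have e4 : 'D_('D_U (left_frame k ^~ v) y + christoffel nabla k y U W) tau y =
    'd tau y ('D_U (left_frame k ^~ v) y) + 'd tau y (christoffel nabla k y U W).
  by rewrite deriveE// linearD.
have cancel (A B P Q C : V) : A = P + Q -> B = P + C -> A + C = Q + B.
  by move=> -> ->; rewrite addrCA addrA.
exact: (eq_trans (cancel _ _ _ _ _ e1 e2) (eq_trans (esym e4) e3)).
Qed.

End christoffel.

Lemma is_derive_shift_curve (R : realType) (V : normedModType R) (f : R -> V) (t s : R) df :
  is_derive (t + s) 1 f df -> is_derive s 1 (fun r => f (t + r)) df.
Proof.
move=> [dv <-].
have sE : is_derive s 1 (fun r : R => t + r) 1.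
  by rewrite -[X in is_derive _ _ _ X]add0r; apply: is_deriveD.
have dd : differentiable f (t + s) by exact/derivable1_diffP.
exact: (is_derive_comp_curve sE dd).
Qed.

Lemma is_derive_row_mx (R : realType) (m n : nat) (f : R -> 'rV[R]_m) (g : R -> 'rV[R]_n)
    (t : R) df dg :
  is_derive t 1 f df -> is_derive t 1 g dg ->
  is_derive t 1 (fun s => row_mx (f s) (g s)) (row_mx df dg).
Proof.
move=> /is_derive_mxP fE /is_derive_mxP gE; apply/is_derive_mxP => i j.
case: (split_ordP j) => k ->.
- by rewrite row_mxEl; under eq_fun do rewrite row_mxEl.
- by rewrite row_mxEr; under eq_fun do rewrite row_mxEr.
Qed.

Lemma row_mx_norm_l (R : realType) (m n : nat) (a : 'rV[R]_m) (b : 'rV[R]_n) :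
  `|a| <= `|row_mx a b|.
Proof.
apply: mx_norm_le => // i j.
by have := mx_norm_coord (row_mx a b) i (lshift n j); rewrite row_mxEl.
Qed.

Lemma row_mx_norm_r (R : realType) (m n : nat) (a : 'rV[R]_m) (b : 'rV[R]_n) :
  `|b| <= `|row_mx a b|.
Proof.
apply: mx_norm_le => // i j.
by have := mx_norm_coord (row_mx a b) i (rshift m j); rewrite row_mxEr.
Qed.

Lemma row_mx_norm_le (R : realType) (m n : nat) (a : 'rV[R]_m) (b : 'rV[R]_n) M :
  `|a| <= M -> `|b| <= M -> `|row_mx a b| <= M.
Proof.
move=> aM bM; apply: mx_norm_le => [|i j]; first exact: le_trans aM.
case: (split_ordP j) => k ->; rewrite ?row_mxEl ?row_mxEr.
- exact: le_trans (mx_norm_coord _ _ _) aM.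
- exact: le_trans (mx_norm_coord _ _ _) bM.
Qed.

Lemma linear_norm_bound (R : realType) (n : nat) (W : normedModType R)
    (f : 'rV[R]_n -> W) C w : linear f -> 0 <= C ->
  (forall l, `|f (delta_mx 0 l)| <= C) -> `|f w| <= n%:R * C * `|w|.
Proof.
move=> lf C0 fC; rewrite (linear_sum_coord w lf) (le_trans (ler_norm_sum _ _ _))//.
have -> : n%:R * C * `|w| = \sum_(k < n) `|w| * C.
  by rewrite sumr_const card_ord -mulrA mulr_natl [C * _]mulrC.
by apply: ler_sum => k _; rewrite normrZ ler_pM// mx_norm_coord.
Qed.

Lemma bilinear_norm_bound (R : realType) (n : nat) (W : normedModType R)
    (b : 'rV[R]_n -> 'rV[R]_n -> W) C u w :
  (forall u, linear (b u)) -> (forall v, linear (b^~ v)) -> 0 <= C ->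
  (forall l m, `|b (delta_mx 0 l) (delta_mx 0 m)| <= C) ->
  `|b u w| <= n%:R * (n%:R * C) * `|u| * `|w|.
Proof.
move=> br bl C0 bC.
have -> : n%:R * (n%:R * C) * `|u| * `|w| = n%:R * (n%:R * C * `|u|) * `|w| by ring.
apply: linear_norm_bound => //; first by rewrite !mulr_ge0.
move=> m; apply: (@linear_norm_bound _ _ _ (b^~ (delta_mx 0 m))) => //.
Qed.

Lemma linear_sub (F : fieldType) (V W : lmodType F) (f : V -> W) :
  linear f -> forall a b, f (a - b) = f a - f b.
Proof.
move=> lf a b; have := lf (-1) b a; rewrite !scaleN1r => e.
by rewrite (addrC a) e addrC.
Qed.

(** * Uniqueness of geodesics *)

Section geodesic_uniqueness.
Context {R : realType} {n : nat} {M : smoothManifoldType R n}.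
Local Notation V := 'rV[R]_n.
Context (nabla : connection M).

Lemma christoffel_locally_lipschitz (i : @chart_idx R n M) z0 : ccod (atlas i) z0 ->
  exists2 r : R, 0 < r & exists2 K, 0 <= K & forall z, `|z - z0| <= r -> forall u w : V,
    `|christoffel nabla i z u w| <= K * `|u| * `|w| /\
    forall z', `|z' - z0| <= r ->
      `|christoffel nabla i z u w - christoffel nabla i z' u w| <=
      K * `|z - z'| * `|u| * `|w|.
Proof.
move=> iz0.
have := @C1_locally_lipschitz_family R n n ('I_n * 'I_n)%type (ccod (atlas i))
  (fun a z => christoffel nabla i z (delta_mx 0 a.1) (delta_mx 0 a.2)) z0
  (@ccod_open _ _ _ _) iz0 (fun a => christoffel_smooth nabla i _ _ 1%N).
move=> [r r0 [L L0 H]]; exists r => //.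
exists (n%:R * (n%:R * L)); first by rewrite !mulr_ge0.
move=> z zr u w; have [_ Hz] := H z zr.
have cl z' v : linear (christoffel nabla i z' ^~ v) by exact: christoffel_linearl.
have cr z' v : linear (christoffel nabla i z' v) by exact: christoffel_linearr.
split.
  apply: (@bilinear_norm_bound _ _ _ (christoffel nabla i z)) => // l m.
  by have [] := Hz (l, m).
move=> z' z'r.
have -> : n%:R * (n%:R * L) * `|z - z'| = n%:R * (n%:R * (L * `|z - z'|)) by ring.
apply: (@bilinear_norm_bound _ _ _
  (fun u w => christoffel nabla i z u w - christoffel nabla i z' u w)).
- by move=> v a p q; rewrite !cr scalerBr opprD addrACA.
- by move=> v a p q; rewrite !cl scalerBr opprD addrACA.
- by rewrite mulr_ge0.
- by move=> l m; have [_ /(_ z' z'r)] := Hz (l, m).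
Qed.

(** Position and velocity differences in chart i, stacked in one row, satisfy a linear differential
    inequality as long as both velocities stay below E; [gronwall_unique] then applies. *)
Lemma geodesic_germ_unique (J : set R) (g1 g2 : R -> M) (i : @chart_idx R n M) (t0 : R) :
  open J -> J t0 -> is_geodesic nabla J g1 -> is_geodesic nabla J g2 ->
  cdom (atlas i) (g1 t0) -> g1 t0 = g2 t0 ->
  derive1 (fun s => cphi (atlas i) (g1 s)) t0 = derive1 (fun s => cphi (atlas i) (g2 s)) t0 ->
  \forall t \near t0, g1 t = g2 t.
Proof.
move=> Jo Jt0 geo1 geo2 it0 g12 dg12.
pose c1 s := cphi (atlas i) (g1 s); pose c2 s := cphi (atlas i) (g2 s).
pose e1 := derive1 c1; pose e2 := derive1 c2.
pose z0 := c1 t0.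
have e12 : e1 t0 = e2 t0 := dg12.
have c12 : c1 t0 = c2 t0 by rewrite /c1 g12.
have [r r0 [K K0 H]] := christoffel_locally_lipschitz (cphi_cod it0).
have geoE g (geo : is_geodesic nabla J g) t : J t -> cdom (atlas i) (g t) ->
    let c s := cphi (atlas i) (g s) in
    is_derive t 1 c (derive1 c t) /\
    is_derive t 1 (derive1 c) (- christoffel nabla i (c t) (derive1 c t) (derive1 c t)).
  move=> Jt it c; have [_ /(_ i it)[d1 d2 /eqP]] := geo t Jt.
  rewrite addr_eq0 => /eqP dd.
  have i1 : is_derive t 1 c (derive1 c t) by split; [exact: d1|rewrite derive1E].
  have i2 : is_derive t 1 (derive1 c) (- christoffel nabla i (c t) (derive1 c t) (derive1 c t)).
    by split; [exact: d2|rewrite -derive1E; exact: dd].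
  by split; [exact: i1|exact: i2].
have it0' : cdom (atlas i) (g2 t0) by rewrite -g12.
have near_good g (geo : is_geodesic nabla J g) : cdom (atlas i) (g t0) ->
    cphi (atlas i) (g t0) = z0 ->
    let c s := cphi (atlas i) (g s) in
    \forall t \near t0, [/\ cdom (atlas i) (g t), `|c t - z0| <= r &
      `|derive1 c t| <= `|derive1 c t0| + 1].
  move=> igt0 cz0 c.
  have [h1 h2] := geoE g geo t0 Jt0 igt0.
  have cg : {for t0, continuous g} by have [] := geo t0 Jt0.
  near=> t; split.
  - near: t; apply: (near_comp cg); apply: open_nbhs_nbhs; split => //.
    exact: cdom_open.
  - near: t; have := is_derive_continuous h1 => /cvgrPdist_le/(_ r r0).
    by apply: filterS => s; rewrite distrC -cz0.
  - near: t; have lt1 : `|derive1 c t0| < `|derive1 c t0| + 1 by rewrite ltrDl.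
    exact: (cvgr_norm_le _ (is_derive_continuous h2) _ lt1).
have n1 : \forall t \near t0, [/\ cdom (atlas i) (g1 t), `|c1 t - z0| <= r &
    `|e1 t| <= `|e1 t0| + 1] := near_good g1 geo1 it0 erefl.
have z02 : cphi (atlas i) (g2 t0) = z0 by rewrite -g12.
have n2 : \forall t \near t0, [/\ cdom (atlas i) (g2 t), `|c2 t - z0| <= r &
    `|e2 t| <= `|e2 t0| + 1] := near_good g2 geo2 it0' z02.
have nJ : \forall t \near t0, J t by exact: open_nbhs_nbhs.
pose E := `|e1 t0| + 1.
have E0 : 0 <= E by rewrite addr_ge0.
have [T T0 good] : exists2 T : R, 0 < T & forall t, `|t - t0| <= T ->
    [/\ J t, cdom (atlas i) (g1 t), cdom (atlas i) (g2 t), `|c1 t - z0| <= r &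
      `|c2 t - z0| <= r] /\ `|e1 t| <= E /\ `|e2 t| <= E.
  apply: near_closed_ball.
  apply: filterS (filterI nJ (filterI n1 n2)) => t [Jt [[a1 a2 a3] [b1 b2 b3]]].
  have b3' : `|e2 t| <= E by rewrite /E e12; exact: b3.
  exact: (conj (And5 Jt a1 b1 a2 b2) (conj a3 b3')).
clearbody E.
have KE : 0 <= K * E by exact: mulr_ge0.
pose v s := row_mx (c1 (t0 + s) - c2 (t0 + s)) (e1 (t0 + s) - e2 (t0 + s)).
pose Gam (c e : V) := christoffel nabla i c e e.
pose dv s := row_mx (e1 (t0 + s) - e2 (t0 + s))
  (- Gam (c1 (t0 + s)) (e1 (t0 + s)) - - Gam (c2 (t0 + s)) (e2 (t0 + s))).
(* The 1 accounts for c' = e, K E E for the change of base point in Gamma, and each K E for the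
   change of one of its two velocity arguments. *)
pose lam := 1 + (K * E * E + K * E + K * E).
have KEE : 0 <= K * E * E + K * E + K * E.
  exact: (addr_ge0 (addr_ge0 (mulr_ge0 KE E0) KE) KE).
have lam0 : 0 <= lam by exact: addr_ge0 ler01 KEE.
have T0' := ltW T0.
have inT s : `|s| <= T -> `|t0 + s - t0| <= T by rewrite addrC addKr.
have v0 : v 0 = 0.
  rewrite /v addr0 c12 subrr e12 subrr.
  by apply/rowP => j; case: (split_ordP j) => k ->; rewrite ?row_mxEl ?row_mxEr !mxE.
have vE (s : R) : `|s| <= T -> is_derive s 1 v (dv s).
  move=> /inT /good[[Jt a1 a2 _ _] _].
  have [h1 h1'] := geoE g1 geo1 _ Jt a1; have [h2 h2'] := geoE g2 geo2 _ Jt a2.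
  apply: is_derive_row_mx.
    exact: (@is_derive_shift_curve _ _ (fun t => c1 t - c2 t) _ _ _ (is_deriveB h1 h2)).
  exact: (@is_derive_shift_curve _ _ (fun t => e1 t - e2 t) _ _ _ (is_deriveB h1' h2')).
have vB s : `|s| <= T -> `|dv s| <= lam * `|v s|.
  move=> /inT /good[[_ _ _ z1 z2] [x1 x2]].
  have nl : `|c1 (t0 + s) - c2 (t0 + s)| <= `|v s| by exact: row_mx_norm_l.
  have nr : `|e1 (t0 + s) - e2 (t0 + s)| <= `|v s| by exact: row_mx_norm_r.
  rewrite /dv; move: z1 z2 x1 x2 nl nr.
  move: (c1 (t0 + s)) (c2 (t0 + s)) (e1 (t0 + s)) (e2 (t0 + s)) (v s).
  move=> p1 p2 q1 q2 vs z1 z2 x1 x2 nl nr.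
  have vs0 : 0 <= `|vs| by [].
  apply: row_mx_norm_le.
    by rewrite (le_trans nr)// /lam mulrDl mul1r lerDl mulr_ge0.
  have -> : - Gam p1 q1 - - Gam p2 q2 = - ((christoffel nabla i p1 q1 q1 -
      christoffel nabla i p2 q1 q1) + christoffel nabla i p2 (q1 - q2) q1 +
      christoffel nabla i p2 q2 (q1 - q2)).
    have -> : christoffel nabla i p2 (q1 - q2) q1 =
        christoffel nabla i p2 q1 q1 - christoffel nabla i p2 q2 q1.
      exact: (linear_sub (christoffel_linearl nabla i p2 q1)).
    have -> : christoffel nabla i p2 q2 (q1 - q2) =
        christoffel nabla i p2 q2 q1 - christoffel nabla i p2 q2 q2.
      exact: (linear_sub (christoffel_linearr nabla i p2 q2)).
    rewrite /Gam; move: (christoffel _ _ _ _ _) (christoffel _ _ p2 q1 q1)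
      (christoffel _ _ p2 q2 q1) (christoffel _ _ p2 q2 q2) => a b c d.
    by apply/rowP => j; rewrite !mxE; ring.
  rewrite normrN /lam mulrDl.
  have h1 : `|christoffel nabla i p1 q1 q1 - christoffel nabla i p2 q1 q1| <=
      K * E * E * `|vs|.
    have [_ /(_ p2 z2)] := H p1 z1 q1 q1; move/le_trans; apply.
    have -> : K * E * E * `|vs| = K * `|vs| * E * E by ring.
    by rewrite !ler_pM// ?mulr_ge0// ler_wpM2l.
  have h2 : `|christoffel nabla i p2 (q1 - q2) q1| <= K * E * `|vs|.
    have [+ _] := H p2 z2 (q1 - q2) q1; move/le_trans; apply.
    have -> : K * E * `|vs| = K * `|vs| * E by ring.
    by rewrite !ler_pM// ?mulr_ge0// ler_wpM2l.
  have h3 : `|christoffel nabla i p2 q2 (q1 - q2)| <= K * E * `|vs|.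
    have [+ _] := H p2 z2 q2 (q1 - q2); move/le_trans; apply.
    by rewrite !ler_pM// ?mulr_ge0// ler_wpM2l.
  apply: le_trans (ler_normD _ _) _.
  have := ler_normD (christoffel nabla i p1 q1 q1 - christoffel nabla i p2 q1 q1)
    (christoffel nabla i p2 (q1 - q2) q1).
  move: h1 h2 h3; rewrite 2!mulrDl mul1r.
  move: `|_ + christoffel _ _ _ _ _| `|_ - _| `|christoffel _ _ _ (q1 - q2) _|
    `|christoffel _ _ _ _ (q1 - q2)| => a1 a2 a3 a4; lra.
pose Lam (s : R) := lam * s.
have LamE (s : R) : is_derive s 1 Lam lam.
  have := @is_deriveZ _ _ _ (@id R) lam s 1 1 (is_derive_id s 1).
  by rewrite /GRing.scale /= mulr1.
have Lam0 : Lam 0 = 0 by rewrite /Lam mulr0.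
have v_eq0 := @gronwall_unique R (fun=> lam) Lam _ _ v dv T (fun=> lam0) Lam0 LamE T0' v0 vE vB.
have near_T : \forall t \near t0, `|t - t0| <= T.
  have cT : {for t0, continuous (fun t : R => t - t0)}.
    by apply: cvgB; [exact: cvg_id|exact: cvg_cst].
  have : `|t0 - t0| < T by rewrite subrr normr0.
  exact: (cvgr_norm_le _ cT).
apply: filterS near_T => t tT.
have := v_eq0 (t - t0) tT; rewrite /v [t0 + _]addrC subrK => /eqP.
rewrite row_mx_eq0 subr_eq0 => /andP[/eqP c12t _].
have [[_ a1 a2 _ _] _] := good t tT.
by rewrite -(cphiK a1) -(cphiK a2) -/(c1 t) c12t.
Unshelve. all: by end_near. Qed.

End geodesic_uniqueness.

Section geodesic_connectedness.
Context {R : realType} {n : nat} {M : smoothManifoldType R n}.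
Local Notation V := 'rV[R]_n.
Context (nabla : connection M).

Lemma eq_of_closure (g1 g2 : R -> M) t :
  {for t, continuous g1} -> {for t, continuous g2} ->
  closure [set s | g1 s = g2 s] t -> g1 t = g2 t.
Proof.
move=> c1 c2 cl; apply: (@manifold_hausdorff R n M) => A B nA nB.
have [s [/= gs [As Bs]]] := cl _ (filterI (near_comp c1 nA) (near_comp c2 nB)).
by exists (g1 s); split => //; rewrite gs.
Qed.

(** The set A where the germs agree is open in J by definition. It is closed in J because positions
    (M being Hausdorff) and velocities agree at a limit point, where [geodesic_germ_unique] restores
    equality of germs. *)
Lemma geodesic_unique (J : set R) (g1 g2 : R -> M) (t0 : R) :
  open J -> is_interval J -> is_geodesic nabla J g1 -> is_geodesic nabla J g2 ->
  J t0 -> (\forall t \near t0, g1 t = g2 t) -> forall t, J t -> g1 t = g2 t.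
Proof.
move=> Jo Ji geo1 geo2 Jt0 near0.
pose A := [set t | J t /\ \forall s \near t, g1 s = g2 s].
have Jc : connected J by exact/connected_intervalP.
suff -> : J = A by move=> t [_ /nbhs_singleton].
apply/esym/Jc.
- by exists t0.
- exists [set t | \forall s \near t, g1 s = g2 s].
    by rewrite openE => t /= /near_join.
  by [].
exists (closure A); first exact: closed_closure.
apply/seteqP; split=> t.
  by move=> At; split; [case: At|exact: subset_closure].
move=> [Jt clA]; split => //.
have [cg1 _] := geo1 t Jt; have [cg2 _] := geo2 t Jt.
have g12 : g1 t = g2 t.
  apply: eq_of_closure => //.
  by apply: closure_subset clA => s [_ /nbhs_singleton].
pose i := @chart_at R n M (g1 t).
have it1 : cdom (atlas i) (g1 t) by exact: chart_at_dom.
have it2 : cdom (atlas i) (g2 t) by rewrite -g12.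
apply: (geodesic_germ_unique Jo Jt geo1 geo2 it1 g12).
have [_ /(_ i it1)[_ dd1 _]] := geo1 t Jt.
have [_ /(_ i it2)[_ dd2 _]] := geo2 t Jt.
have cd1 := is_derive_continuous (derivableP dd1).
have cd2 := is_derive_continuous (derivableP dd2).
move: cd1 cd2.
set e1 := derive1 _; set e2 := derive1 _ => cd1 cd2.
apply: (@norm_hausdorff _ V) => B C nB nC.
have [s [[Js As] [Bs Cs]]] := clA _ (filterI (near_comp cd1 nB) (near_comp cd2 nC)).
exists (e1 s); split => //; suff -> : e1 s = e2 s by [].
rewrite /e1 /e2 !derive1E; apply: near_eq_derive.
by apply: filterS As => r ->.
Qed.

End geodesic_connectedness.

(** * Curves with prescribed left-invariant velocity *)

Section trajectories.
Context {R : realType} {n : nat} {G : lieGroupType R n}.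
Local Notation V := 'rV[R]_n.
Context (bullet : lie_algebra G -> lie_algebra G -> lie_algebra G).
Context (nabla : connection G).
Hypothesis nablaE : forall (u v : lie_algebra G) (g : G),
  covariant nabla (left_invariant_vf u) (left_invariant_vf v) g =
  left_invariant_vf (bullet u v) g.

(* [x t] is the velocity of the curve [s] at time [t], translated to the identity. *)
Definition trajectory (x : R -> V) (J : set R) (s : R -> G) : Prop :=
  forall t, J t -> {for t, continuous s} /\
  forall i : @chart_idx R n G, cdom (atlas i) (s t) ->
    is_derive t 1 (fun r => cphi (atlas i) (s r))
      (left_frame i (cphi (atlas i) (s t)) (x t)).

(** Differentiating c' = frame(c) x gives the derivative of the frame minus frame(c) (x.x), which is
    - Gamma(c', c') by [christoffel_left_frame_chart]. *)
Lemma trajectory_geodesic (x : R -> V) (J : set R) (s : R -> G) : open J ->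
  (forall t : R, is_derive t 1 x (- (bullet (x t) (x t) : V))) ->
  trajectory x J s -> is_geodesic nabla J s.
Proof.
move=> Jo xE traj t Jt; have [cs sE] := traj t Jt; split => // i it c.
have cE := sE i it.
have ict : ccod (atlas i) (c t) by exact: cphi_cod.
have near_c : \forall r \near t, derive1 c r = left_frame i (c r) (x r).
  have n1 : \forall r \near t, cdom (atlas i) (s r).
    by apply: (near_comp cs); apply: open_nbhs_nbhs; split => //; exact: cdom_open.
  have n2 : \forall r \near t, J r by exact: open_nbhs_nbhs.
  apply: filterS (filterI n1 n2) => r [ir Jr].
  have [_ /(_ i ir) [_ h]] := traj r Jr.
  by rewrite derive1E; exact: h.
have lE u : is_derive t 1 (fun r => left_frame i (c r) u)
    ('D_(left_frame i (c t) (x t)) (left_frame i ^~ u) (c t)).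
  exact: (is_derive_comp_curve cE (left_frame_diff_base u ict)).
have := is_derive_frozen (fun r => left_frame_linear i (c r)) lE (xE t).
have -> : left_frame i (c t) (- (bullet (x t) (x t) : V)) =
    - left_frame i (c t) (bullet (x t) (x t)).
  have := linear_sub (left_frame_linear i (c t)) 0 (bullet (x t) (x t)).
  have -> : left_frame i (c t) 0 = 0.
    by have := linear_sub (left_frame_linear i (c t)) 0 0; rewrite !subrr.
  by rewrite !sub0r.
rewrite -(christoffel_left_frame_chart nablaE _ _ ict) opprD addrA subrr add0r => c2E.
have e : derive1 c t = left_frame i (c t) (x t) by exact: nbhs_singleton near_c.
have near_c' : \forall r \near t, left_frame i (c r) (x r) = derive1 c r.
  by apply: filterS near_c => r ->.
have [d1 d2] := near_eq_is_derive near_c' c2E.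
split; first by have [] := cE.
  exact: d1.
by rewrite [X in X + _]derive1E d2 e addrC subrr.
Qed.

End trajectories.

Lemma clamp_lipschitz (R : realType) (r a b : R) :
  `|Num.max (- r) (Num.min r a) - Num.max (- r) (Num.min r b)| <= `|a - b|.
Proof.
wlog ab : a b / a <= b.
  by move=> H; have [/H//|/ltW/H] := leP a b; rewrite distrC (distrC b).
rewrite [`|a - b|]ler0_norm ?subr_le0// ler_norml.
apply/andP; split; rewrite /Num.max /Num.min; do !case: ifPn; rewrite -?leNgt; lra.
Qed.

(* Truncating the frame outside a ball inside a chart makes the equation of a
   trajectory globally Lipschitz. *)
Definition clamp_row (R : realType) (n : nat) (r : R) (z0 z : 'rV[R]_n) : 'rV[R]_n :=
  \row_j (z0 0 j + Num.max (- r) (Num.min r (z 0 j - z0 0 j))).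

Lemma clamp_row_ball (R : realType) (n : nat) (r : R) (z0 z : 'rV[R]_n) :
  0 <= r -> `|clamp_row r z0 z - z0| <= r.
Proof.
move=> r0; apply: mx_norm_le => // i j; rewrite (ord1 i) !mxE addrC addKr ler_norml.
by rewrite le_max lexx /= ge_max ge_min lexx /= andbT; lra.
Qed.

Lemma clamp_row_id (R : realType) (n : nat) (r : R) (z0 z : 'rV[R]_n) :
  `|z - z0| <= r -> clamp_row r z0 z = z.
Proof.
move=> zr; apply/rowP => j; rewrite !mxE.
have := le_trans (mx_norm_coord (z - z0) 0 j) zr; rewrite !mxE ler_norml => /andP[h1 h2].
by rewrite min_r// max_r// addrC subrK.
Qed.

Lemma clamp_row_lipschitz (R : realType) (n : nat) (r : R) (z0 z z' : 'rV[R]_n) :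
  `|clamp_row r z0 z - clamp_row r z0 z'| <= `|z - z'|.
Proof.
apply: mx_norm_le => // i j; rewrite (ord1 i) !mxE.
rewrite opprD addrACA subrr add0r (le_trans (clamp_lipschitz _ _ _))//.
have -> : z 0 j - z0 0 j - (z' 0 j - z0 0 j) = (z - z') 0 j by rewrite !mxE; ring.
exact: mx_norm_coord.
Qed.

Lemma clamp_row_continuous (R : realType) (n : nat) (r : R) (z0 : 'rV[R]_n) :
  continuous (clamp_row r z0).
Proof.
move=> z; apply/(@cvgrPdist_le _ _ _ (nbhs z)) => e e0.
have B : \forall z' \near z, `|z - z'| <= e.
  by apply/nbhs_ballP; exists e => // z'; rewrite -ball_normE /= => /ltW.
by apply: filterS B => z'; exact/le_trans/clamp_row_lipschitz.
Qed.

(** * Local existence with a uniform time step *)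

Section trajectory_existence.
Context {R : realType} {n : nat} {G : lieGroupType R n}.
Local Notation V := 'rV[R]_n.
Local Notation z0 := (phi_at (1%g : G) 1%g).
Local Notation psi0 := (psi_at (1%g : G)).
Local Notation k0 := (@chart_at R n G 1%g).

Lemma left_frame_locally_lipschitz : exists2 r : R, 0 < r & exists2 L, 0 <= L &
  forall z, `|z - z0| <= r -> ccod (atlas k0) z /\ forall w : V,
    `|left_frame k0 z w| <= L * `|w| /\
    forall z', `|z' - z0| <= r ->
      `|left_frame k0 z w - left_frame k0 z' w| <= L * `|w| * `|z - z'|.
Proof.
have := @C1_locally_lipschitz_family R n n 'I_n (ccod (atlas k0))
  (fun l z => left_frame k0 z (delta_mx 0 l)) z0
  (@ccod_open _ _ _ _) (cod_phi_at _) (fun l => left_frame_smooth k0 _ 1%N).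
move=> [r r0 [L L0 H]]; exists r => //; exists (n%:R * L); first by rewrite mulr_ge0.
move=> z zr; have [kz Hz] := H z zr; split => // w; split.
  apply: linear_norm_bound => //; first exact: left_frame_linear.
  by move=> l; have [] := Hz l.
move=> z' z'r.
have -> : n%:R * L * `|w| * `|z - z'| = n%:R * (L * `|z - z'|) * `|w| by ring.
apply: (@linear_norm_bound _ _ _ (fun w => left_frame k0 z w - left_frame k0 z' w)).
- by move=> a p q; rewrite !left_frame_linear scalerBr opprD addrACA.
- by rewrite mulr_ge0.
- by move=> l; have [_ /(_ z' z'r)] := Hz l.
Qed.

(** The equation is solved near the identity only and the solution is then translated by [g0], so
    [eps] depends on the time range alone. *)
Lemma trajectory_local (x : R -> V) (T : R) : continuous x -> 0 <= T ->
  exists2 eps : R, 0 < eps & forall t0, `|t0| <= T -> forall g0 : G,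
    exists2 s, s t0 = g0 & trajectory x [set t | `|t - t0| < eps] s.
Proof.
move=> cx T0; have [r r0 [L L0 H]] := left_frame_locally_lipschitz.
have T10 : 0 <= T + 1 by rewrite addr_ge0.
have [X X0 xX] := continuous_bounded_segment T10 (fun t _ => cx t).
pose K := L * X; have K0 : 0 <= K by exact: mulr_ge0.
have K10 : 0 < K + 1 by rewrite ltr_wpDl.
(* K bounds the speed for |t| <= 1, so the solution stays in the ball of radius r, where truncation
   has no effect, up to this time. The 1 added to K avoids a zero denominator. *)
pose eps := Num.min 1 (r / (K + 1)).
have eps0 : 0 < eps by rewrite lt_min ltr01 divr_gt0.
exists eps => // t0 t0T g0.
pose cl := clamp_row r z0.
have clr z : `|cl z - z0| <= r by apply: clamp_row_ball; exact: ltW.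
pose f t c := left_frame k0 (cl c) (x (t0 + t)).
have cxt : continuous (fun t => x (t0 + t)).
  move=> t; apply: (@continuous_comp _ _ _ (fun t => t0 + t) x); last exact: cx.
  by apply: cvgD; [exact: cvg_cst|exact: cvg_id].
have [c [c0 cE]] : exists c : R -> V, c 0 = z0 /\
    forall t : R, is_derive t 1 c (f t (c t)).
  apply: (@picard_lindelof _ _ _ f (fun t => L * `|x (t0 + t)|)).
  - move=> t; apply: cvgM; first exact: cvg_cst.
    apply: (@continuous_comp _ _ _ (fun t => x (t0 + t)) (fun w : V => `|w|)).
      exact: cxt.
    exact: norm_continuous.
  - by move=> t; rewrite mulr_ge0.
  - move=> t u w; have [_ /(_ (x (t0 + t)))[_ /(_ (cl w) (clr w)) h]] := H _ (clr u).
    apply: le_trans h _; rewrite ler_wpM2l ?mulr_ge0//.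
    exact: clamp_row_lipschitz.
  - move=> u cu t.
    have -> : (fun t => f t (u t)) = (fun t => \sum_l
        x (t0 + t) 0 l *: left_frame k0 (cl (u t)) (delta_mx 0 l)).
      by apply/funext => t'; rewrite /f (linear_sum_coord _ (left_frame_linear _ _)).
    apply: cvg_big => [|l _]; first exact: add_continuous.
    apply: cvgZ.
      apply: (@continuous_comp _ _ _ (fun t => x (t0 + t)) (fun w : V => w 0 l)).
        exact: cxt.
      exact: coord_continuous.
    apply: (@continuous_comp _ _ _ (fun t => cl (u t)) (left_frame k0 ^~ (delta_mx 0 l))).
      apply: (@continuous_comp _ _ _ u cl); first exact: cu.
      exact: clamp_row_continuous.
    apply: differentiable_continuous; apply: left_frame_diff_base.
    by have [] := H _ (clr (u t)).
have fK t : `|t| <= 1 -> `|f t (c t)| <= K.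
  move=> t1; have [_ /(_ (x (t0 + t)))[h _]] := H _ (clr (c t)).
  apply: le_trans h _; rewrite ler_wpM2l// xX//.
  by rewrite (le_trans (ler_normD _ _))// lerD.
have c_ball t : `|t| < eps -> `|c t - z0| <= r.
  rewrite lt_min => /andP[/ltW t1 tr].
  have Kt : K * `|t| <= r.
    move: tr; rewrite ltr_pdivlMr// mulrDr mulr1 mulrC => h.
    by rewrite (le_trans _ (ltW h))// lerDl.
  have [tp|/ltW tn] := leP 0 t.
    rewrite -c0; apply: le_trans (mean_value_bound tp K0 (fun s _ => cE s) _) _.
      move=> s /andP[s0 st]; apply: fK; rewrite ger0_norm// (le_trans st)//.
      by rewrite (le_trans (ler_norm t)).
    by rewrite subr0 -{1}(ger0_norm tp).
  rewrite -c0 distrC; apply: le_trans (mean_value_bound tn K0 (fun s _ => cE s) _) _.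
    move=> s /andP[ts s0]; apply: fK; rewrite ler0_norm// (le_trans _ t1)//.
    by rewrite ler0_norm// lerN2.
  by rewrite sub0r -(ler0_norm tn).
exists (fun t => (g0 * psi0 (c (- t0 + t)))%g).
  by rewrite addNr c0 psi0_z0 mulg1.
move=> t /= tt0.
have tt0' : `|- t0 + t| < eps by rewrite addrC.
have kc : ccod (atlas k0) (c (- t0 + t)) by have [] := H _ (c_ball _ tt0').
pose d r := c (- t0 + r).
have dE : is_derive t 1 d (left_frame k0 (d t) (x t)).
  have := is_derive_shift_curve (cE (- t0 + t)).
  by rewrite /f /cl (clamp_row_id (c_ball _ tt0')) addNKr.
split=> [|i it].
  apply: (@continuous_comp _ _ _ d (fun z => g0 * psi0 z)%g).
    exact: is_derive_continuous dE.
  exact: mulg_psi_continuous.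
have dg : differentiable (fun z => cphi (atlas i) (g0 * psi0 z)%g) (d t).
  exact: translation_differentiable.
have := is_derive_comp_curve dE dg.
by rewrite left_frame_translation.
Qed.

(** A preimage of w is its image under the differential of left translation by the inverse of the
    base point. *)
Lemma left_frame_surjective (i : @chart_idx R n G) (x w : V) : ccod (atlas i) x ->
  exists u, left_frame i x u = w.
Proof.
move=> ix; set g := cpsi (atlas i) x.
have gx : (g^-1 * cpsi (atlas i) x)%g = 1%g by rewrite mulVg.
have d1 : cdom (atlas k0) (g^-1 * cpsi (atlas i) x)%g.
  by rewrite gx; exact: chart_at_dom.
pose h (y : V) : V := cphi (atlas k0) (g^-1 * cpsi (atlas i) y)%g.
have dh : differentiable h x by exact: translation_differentiable.
exists ('D_w h x); rewrite left_frameE//.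
have hx : h x = z0 by rewrite /h gx.
pose k (z : V) : V := cphi (atlas i) (g * psi0 z)%g.
have dk : differentiable k (h x) by rewrite hx; exact: left_frame_differentiable.
have e := derive_comp w dh dk; rewrite hx in e.
apply: (eq_trans (esym e)).
rewrite -[RHS](derive_id x w); apply: near_eq_derive.
apply: filterS (near_mulg_psi ix d1) => y [iy dy].
by rewrite /= /k /h /psi_at cphiK// mulgA mulgV mul1g cpsiK.
Qed.

End trajectory_existence.

(** * Global existence of trajectories *)

Section trajectory_global.
Context {R : realType} {n : nat} {G : lieGroupType R n}.
Local Notation V := 'rV[R]_n.
Context (bullet : lie_algebra G -> lie_algebra G -> lie_algebra G).
Context (nabla : connection G).
Hypothesis nablaE : forall (u v : lie_algebra G) (g : G),
  covariant nabla (left_invariant_vf u) (left_invariant_vf v) g =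
  left_invariant_vf (bullet u v) g.
Context (x : R -> V).
Hypothesis xE : forall t : R, is_derive t 1 x (- (bullet (x t) (x t) : V)).

Let cx : continuous x.
Proof. by move=> t; exact: is_derive_continuous (xE t). Qed.

Lemma trajectory_sub (J J' : set R) (s : R -> G) :
  J' `<=` J -> trajectory x J s -> trajectory x J' s.
Proof. by move=> JJ traj t /JJ; exact: traj. Qed.

Lemma trajectory_near (J : set R) (s s' : R -> G) : trajectory x J s ->
  (forall t, J t -> \forall r \near t, s r = s' r) -> trajectory x J s'.
Proof.
move=> traj ss' t Jt; have [cs sE] := traj t Jt.
have near_s := ss' t Jt; have st : s t = s' t := nbhs_singleton near_s.
split=> [|i].
  have : s r @[r --> t] --> s' t by rewrite -st; exact: cs.
  by apply: cvg_trans; apply: near_eq_cvg; apply: filterS near_s => r ->.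
rewrite -st => /sE; apply: near_eq_is_derive.
by apply: filterS near_s => r ->.
Qed.

(** Two trajectories of the same x are geodesics with equal position and velocity at [t0]. *)
Lemma trajectory_unique (J : set R) (s1 s2 : R -> G) t0 : open J -> is_interval J ->
  trajectory x J s1 -> trajectory x J s2 -> J t0 -> s1 t0 = s2 t0 ->
  forall t, J t -> s1 t = s2 t.
Proof.
move=> Jo Ji traj1 traj2 Jt0 s12.
have geo1 := trajectory_geodesic nablaE Jo xE traj1.
have geo2 := trajectory_geodesic nablaE Jo xE traj2.
apply: (geodesic_unique Jo Ji geo1 geo2 Jt0).
pose i := @chart_at R n G (s1 t0).
have it1 : cdom (atlas i) (s1 t0) by exact: chart_at_dom.
have it2 : cdom (atlas i) (s2 t0) by rewrite -s12.
apply: (geodesic_germ_unique Jo Jt0 geo1 geo2 it1 s12).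
have [_ /(_ i it1)[_ d1]] := traj1 t0 Jt0.
have [_ /(_ i it2)[_ d2]] := traj2 t0 Jt0.
rewrite !derive1E; apply: (eq_trans d1); apply: (eq_trans _ (esym d2)).
exact: (congr1 (fun g => left_frame i (cphi (atlas i) g) (x t0)) s12).
Qed.

Lemma trajectory_glue (J1 J2 : set R) (s1 s2 : R -> G) t0 : open J1 -> open J2 ->
  is_interval J1 -> is_interval J2 -> trajectory x J1 s1 -> trajectory x J2 s2 ->
  J1 t0 -> J2 t0 -> s1 t0 = s2 t0 ->
  exists2 s, trajectory x (J1 `|` J2) s & forall t, J1 t -> s t = s1 t.
Proof.
move=> o1 o2 i1 i2 traj1 traj2 J1t0 J2t0 s12.
have i12 : is_interval (J1 `&` J2).
  move=> a b [a1 a2] [b1 b2] c acb.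
  by split; [exact: i1 a1 b1 _ acb|exact: i2 a2 b2 _ acb].
have agree := @trajectory_unique (J1 `&` J2) s1 s2 t0 (openI o1 o2) i12
  (trajectory_sub (@subIsetl _ _ _) traj1) (trajectory_sub (@subIsetr _ _ _) traj2)
  (conj J1t0 J2t0) s12.
pose s t := if pselect (J1 t) then s1 t else s2 t.
have sE1 t : J1 t -> s t = s1 t by rewrite /s; case: pselect.
have sE2 t : J2 t -> s t = s2 t.
  by rewrite /s; case: pselect => // J1t J2t; exact: agree.
exists s => //.
have t1 : trajectory x J1 s.
  apply: (trajectory_near traj1) => t Jt.
  by apply: (near_open o1 Jt) => r Jr; rewrite sE1.
have t2 : trajectory x J2 s.
  apply: (trajectory_near traj2) => t Jt.
  by apply: (near_open o2 Jt) => r Jr; rewrite sE2.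
by move=> t [/t1|/t2].
Qed.

Let itvo (a b : R) : open `]a, b[%classic.
Proof. exact: interval_open. Qed.

Let itvi (a b : R) : is_interval `]a, b[%classic.
Proof. exact: interval_is_interval. Qed.

Lemma trajectory_bounded (t0 A : R) (g0 : G) : 0 < A ->
  exists2 s, s t0 = g0 & trajectory x `]t0 - A, t0 + A[ s.
Proof.
move=> A0; have T0 : 0 <= `|t0| + A by rewrite addr_ge0// ltW.
have [eps eps0 loc] := trajectory_local (G := G) cx T0.
have {}loc (c : R) (g : G) : `|c| <= `|t0| + A ->
    exists2 s, s c = g & trajectory x `]c - eps, c + eps[ s.
  move=> /loc/(_ g)[s sc traj]; exists s => //; apply: trajectory_sub traj => t /=.
  by rewrite in_itv /= -ltr_distl.
pose eta := eps / 2.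
have eta0 : 0 < eta by rewrite divr_gt0.
have ee : eps = eta + eta by rewrite /eta -splitr.
have step m : m%:R * eta <= A ->
    exists2 s, s t0 = g0 & trajectory x `]t0 - m.+1%:R * eta, t0 + m.+1%:R * eta[ s.
  elim: m => [_|m IH mA].
    have t0T : `|t0| <= `|t0| + A by rewrite lerDl ltW.
    have [s st traj] := loc t0 g0 t0T; exists s => //.
    apply: trajectory_sub traj => t /=; rewrite !in_itv /= mul1r ee.
    by move=> /andP[? ?]; apply/andP; split; lra.
  have [|s st traj] := IH.
    by apply: le_trans mA; rewrite ler_wpM2r ?ler_nat ?ltW.
  pose a := m.+1%:R * eta; rewrite -/a in mA traj.
  have aE : m.+2%:R * eta = a + eta by rewrite /a -natr1 mulrDl mul1r.
  have ae : eta <= a by apply: ler_peMl; [exact: ltW|rewrite ler1n].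
  rewrite aE; have t0l := lerNnormlW (lexx `|t0|); have t0r := ler_norm t0.
  (* The restart points lie eta / 2 inside the current interval, where the curves can be glued; a
     local solution of half-width 2 eta then reaches beyond the new end. The bound a <= A keeps both
     points in the range where [loc] holds. *)
  pose c := t0 + a - eta / 2; pose c' := t0 - a + eta / 2.
  have cT : `|c| <= `|t0| + A by rewrite ler_norml /c; apply/andP; split; lra.
  have cT' : `|c'| <= `|t0| + A by rewrite ler_norml /c'; apply/andP; split; lra.
  have [s2 s2c traj2] := loc c (s c) cT.
  have [||s3 traj3 s3E] := trajectory_glue (@itvo _ _) (@itvo _ _) (@itvi _ _) (@itvi _ _)
    traj traj2 _ _ (esym s2c).
  - by rewrite /= in_itv /= /c; apply/andP; split; lra.
  - by rewrite /= in_itv /= ; apply/andP; split; lra.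
  have {}traj3 : trajectory x `]t0 - a, t0 + a + eta[ s3.
    apply: trajectory_sub traj3 => t /=; rewrite !in_itv /= => /andP[h1 h2].
    have [h|h] := ltP t (t0 + a); [left|right]; rewrite ?in_itv /= ?ee /c; lra.
  have [s4 s4c traj4] := loc c' (s3 c') cT'.
  have [||s5 traj5 s5E] := trajectory_glue (@itvo _ _) (@itvo _ _) (@itvi _ _) (@itvi _ _)
    traj3 traj4 _ _ (esym s4c).
  - by rewrite /= in_itv /= /c'; apply/andP; split; lra.
  - by rewrite /= in_itv /= ; apply/andP; split; lra.
  exists s5.
    rewrite s5E ?s3E// /= in_itv /=; apply/andP; split; lra.
  apply: trajectory_sub traj5 => t /=; rewrite !in_itv /= => /andP[h1 h2].
  have [h|h] := ltP (t0 - a) t; [left|right]; rewrite ?in_itv /= ?ee /c'; lra.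
have Ae : 0 <= A / eta by rewrite divr_ge0// ltW.
have [|s st traj] := step (Num.truncn (A / eta)).
  by rewrite -ler_pdivlMr// truncn_le.
exists s => //; apply: trajectory_sub traj => t /=; rewrite !in_itv /= => /andP[h1 h2].
have h : A < (Num.truncn (A / eta)).+1%:R * eta by rewrite -ltr_pdivrMr// truncnS_gt.
by apply/andP; split; lra.
Qed.

(** By uniqueness the solutions on growing intervals extend one another; at time t the one of index
    floor |t - t0| is used, whose interval of radius one more contains t. *)
Lemma trajectory_complete (t0 : R) (g0 : G) :
  exists2 s, s t0 = g0 & trajectory x setT s.
Proof.
have ex (N : nat) := @trajectory_bounded t0 N.+1%:R g0 (ltr0Sn R N).
have ex' (N : nat) : exists s, s t0 = g0 /\
    trajectory x `]t0 - N.+1%:R, t0 + N.+1%:R[ s.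
  by have [s s0 traj] := ex N; exists s.
have [S SE] := choice ex'.
pose N (t : R) := Num.truncn `|t - t0|.
have inN (t : R) (k : nat) : `|t - t0| < k.+1%:R ->
    `]t0 - k.+1%:R, t0 + k.+1%:R[%classic t.
  by rewrite /= in_itv /= ltr_distl.
have int0 (k : nat) : `]t0 - k.+1%:R, t0 + k.+1%:R[%classic t0.
  by apply: inN; rewrite subrr normr0.
pose s t := S (N t) t.
have mono (k l : nat) (t : R) : (k <= l)%N -> `|t - t0| < k.+1%:R -> S k t = S l t.
  move=> kl tk.
  have sub : `]t0 - k.+1%:R, t0 + k.+1%:R[%classic `<=` `]t0 - l.+1%:R, t0 + l.+1%:R[%classic.
    move=> r /=; rewrite !in_itv /= => /andP[h1 h2].
    have h : k.+1%:R <= l.+1%:R :> R by rewrite ler_nat.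
    by apply/andP; split; lra.
  apply: (trajectory_unique (@itvo _ _) (@itvi _ _) (SE k).2 (trajectory_sub sub (SE l).2)
    (int0 k)); last exact: inN.
  by rewrite (SE k).1 (SE l).1.
have sE k t : `|t - t0| < k.+1%:R -> s t = S k t.
  move=> tk; have tN : `|t - t0| < (N t).+1%:R by exact: truncnS_gt.
  by have [h|/ltnW h] := leqP (N t) k; [exact: mono|rewrite /s (mono k (N t))].
exists s.
  by rewrite (sE 0%N) ?(SE 0%N).1// subrr normr0.
move=> t _; have tN : `|t - t0| < (N t).+1%:R by exact: truncnS_gt.
apply: (trajectory_near (SE (N t)).2 _ (inN _ _ tN)) => r rN.
apply: (near_open (@itvo _ _) rN) => q /=; rewrite in_itv /= -ltr_distl => /sE.
by move=> ->.
Qed.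

End trajectory_global.

Theorem mainTheorem5 (R : realType) (n : nat) (G : lieGroupType R n)
    (Omega : G -> 'rV[R]_n -> 'rV[R]_n -> R)
    (Omega_symplectic : symplectic_form Omega)
    (Omega_left_invariant : left_invariant_form Omega)
    (bullet : lie_algebra G -> lie_algebra G -> lie_algebra G)
    (bulletE : is_natural_product (Omega 1%g) bullet)
    (nabla : connection G)
    (nablaE : forall (u v : lie_algebra G) (g : G),
      covariant nabla (left_invariant_vf u) (left_invariant_vf v) g =
      left_invariant_vf (bullet u v) g)
    (nabla_flat : flat nabla) :
  geodesically_complete nabla.
Proof.
move=> I gamma [t0 It0] Io Ii geo.
pose i := @chart_at R n G (gamma t0).
have it0 : cdom (atlas i) (gamma t0) by exact: chart_at_dom.
(* v is the velocity of [gamma] at [t0], translated to the identity. *)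
have [v vE] := left_frame_surjective
  (derive1 (fun s => cphi (atlas i) (gamma s)) t0) (cphi_cod it0).
have [y [y0 yE]] := bullet_flow_complete Omega_symplectic Omega_left_invariant bulletE
  nablaE nabla_flat v.
(* The flow equation is autonomous, so its solution may be shifted to start at [t0]. *)
pose x t := y (- t0 + t).
have x0 : x t0 = v by rewrite /x addNr.
have xE (t : R) : is_derive t 1 x (- (bullet (x t) (x t) : 'rV[R]_n)).
  exact: is_derive_shift_curve (yE (- t0 + t)).
have [s s0 traj] := trajectory_complete nablaE xE t0 (gamma t0).
have geo_s := trajectory_geodesic nablaE openT xE traj.
exists s; split => //.
have geo_sI : is_geodesic nabla I s by move=> t _; exact: geo_s.
have st0 : cdom (atlas i) (s t0) by rewrite s0.
apply: (geodesic_unique Io Ii geo_sI geo It0).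
apply: (geodesic_germ_unique Io It0 geo_sI geo st0 s0).
have [_ /(_ i st0)[_ d]] := traj t0 Logic.I.
rewrite derive1E; apply: (eq_trans d); apply: (eq_trans _ vE).
exact: (congr2 (fun g w => left_frame i (cphi (atlas i) g) w) s0 x0).
Qed.
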